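(* Suppose that $\kappa \geq K$. Let $\{U^{(\ell)}_{h\tau}\}_{\ell \in \mathbb{N}_0} \subset \mathbb{U}_{h\tau}$ be generated by the gradient descent algorithm described below, and let $U^*_{h\tau}$ be the optimal control of problem $\mathbf{SLQ}_{h\tau}$, with optimal state $X^*_{h\tau}$. Then for $\ell=1,2,\cdots$, (i) $\| U^{(\ell)}_{h\tau}-U^*_{h\tau} \|_{\mathbb{U}_{h\tau}}^2\leq \Big(1-\frac 1 {\kappa}\Big)^{\ell}\| U^{(0)}_{h\tau}-U^*_{h\tau} \|_{\mathbb{U}_{h\tau}}^2$; (ii) $\widehat{\cal J}_{h\tau}(U^{(\ell)}_{h\tau})-\widehat{\cal J}_{h\tau}(U^*_{h\tau})\leq \frac{2 \kappa \Vert U^{(0)}_{h\tau}-U^*_{h\tau} \Vert_{\mathbb{U}_{h\tau}}^2}{\ell}$; (iii) $\max_{0 \leq n \leq N} \mathbb{E}\bigl[\|X_{h\tau}^*(t_n)-X^{(\ell)}_{h\tau}(t_n)\|_{\mathbb{L}^2}^2\bigr] +\tau \sum_{n=1}^N \mathbb{E} \bigl[\|X^*_{h\tau}(t_n)- X^{(\ell)}_{h\tau}(t_n)\|_{\mathbb{H}_0^1}^2\bigr] \leq C\Big(1-\frac 1 {\kappa}\Big)^{\ell}\| U^{(0)}_{h\tau}-U^*_{h\tau} \|_{\mathbb{U}_{h\tau}}^2$, where $C$ is independent of $h,\,\tau,\,\ell$.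
   Context: Let $D\subset\mathbb{R}^d$ be a bounded $C^2$ domain, $T>0$, $\alpha\ge 0$, $W$ a real Wiener process on a filtered probability space with its augmented natural filtration $\{\mathcal{F}_t\}$. Assume $X_0\in \mathbb{H}_0^1\cap\mathbb{H}^3$ and $\sigma\in C^1(0,T;\mathbb{H}_0^1\cap\mathbb{H}^3)$. Let $\mathbb{V}_h\subset \mathbb{H}^1_0$ be the space of continuous piecewise linear finite element functions on a regular triangulation of $D$ with mesh size $h$; $\Delta_h:\mathbb{V}_h\to\mathbb{V}_h$ the discrete Laplacian, $(-\Delta_h \xi_h,\phi_h)_{\mathbb{L}^2}=(\nabla\xi_h,\nabla\phi_h)_{\mathbb{L}^2}$; ${\cal R}_h$ the Ritz projection onto $\mathbb{V}_h$. Let $t_n=n\tau$, $\tau=T/N\le 1$, $\Delta_nW=W(t_n)-W(t_{n-1})$, and $A_0=(\mathds{1}-\tau\Delta_h)^{-1}$. Let $\mathbb{X}_{h\tau}$, $\mathbb{U}_{h\tau}$ be the spaces of adapted $\mathbb{V}_h$-valued square integrable processes that are constant on each $[t_n,t_{n+1})$, with norms $\|X\|_{\mathbb{X}_{h\tau}}^2=\tau\sum_{n=1}^N\mathbb{E}\|X(t_n)\|_{\mathbb{L}^2}^2$ and $\|U\|_{\mathbb{U}_{h\tau}}^2=\tau\sum_{n=0}^{N-1}\mathbb{E}\|U(t_n)\|_{\mathbb{L}^2}^2$. Problem $\mathbf{SLQ}_{h\tau}$: minimize ${\cal J}_\tau(X,U)=\frac12[\|X\|^2_{\mathbb{X}_{h\tau}}+\|U\|^2_{\mathbb{U}_{h\tau}}]+\frac\alpha2\mathbb{E}\|X(T)\|^2_{\mathbb{L}^2}$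 over $U\in\mathbb{U}_{h\tau}$ subject to $X(t_{n+1})-X(t_n)=\tau[\Delta_hX(t_{n+1})+U(t_n)]+[X(t_n)+{\cal R}_h\sigma(t_n)]\Delta_{n+1}W$, $n=0,\dots,N-1$, $X(0)={\cal R}_hX_0$; this problem has a unique optimal pair $(X^*_{h\tau},U^*_{h\tau})$. Denote by ${\cal S}_{h\tau}$ the control-to-state map of this difference equation and $\widehat{\cal J}_{h\tau}(U)={\cal J}_\tau({\cal S}_{h\tau}(U),U)$ the reduced functional. Define $L:\mathbb{U}_{h\tau}\to\mathbb{X}_{h\tau}$ by $(LU)(t_n)=\tau\sum_{j=0}^{n-1}A_0^{n-j}\prod_{k=j+2}^n(1+\Delta_kW)U(t_j)$, $n=1,\dots,N$, and $\widehat LU=(LU)(T)$; then $D^2\widehat{\cal J}_{h\tau}=\mathds{1}+L^*L+\alpha\widehat L^*\widehat L$ and $K:=\|\mathds{1}+L^*L+\alpha\widehat L^*\widehat L\|_{{\cal L}(\mathbb{U}_{h\tau};\mathbb{U}_{h\tau})}\le 1+\alpha Te^T+T^2e^T$ is a Lipschitz constant of $D\widehat{\cal J}_{h\tau}$. The gradient descent algorithm: given $U^{(0)}_{h\tau}\in\mathbb{U}_{h\tau}$ and $\kappa>0$, for $\ell\in\mathbb{N}_0$: (1) compute $X^{(\ell)}_{h\tau}\in\mathbb{X}_{h\tau}$ from $[\mathds{1}-\tau\Delta_h]X^{(\ell)}_{h\tau}(t_{n+1})=X^{(\ell)}_{h\tau}(t_n)+\tau U^{(\ell)}_{h\tau}(t_n)+[X^{(\ell)}_{h\tau}(t_n)+{\cal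 R}_h\sigma(t_n)]\Delta_{n+1}W$, $X^{(\ell)}_{h\tau}(0)={\cal R}_hX_0$; (2) compute $Y^{(\ell)}_{h\tau}(t_n)=-\tau\mathbb{E}\big[\sum_{j=n+1}^NA_0^{j-n}\prod_{k=n+2}^j(1+\Delta_kW)X^{(\ell)}_{h\tau}(t_j)\big|\mathcal{F}_{t_n}\big]-\alpha\mathbb{E}\big[A_0^{N-n}\prod_{k=n+2}^N(1+\Delta_kW)X^{(\ell)}_{h\tau}(T)\big|\mathcal{F}_{t_n}\big]$, $n=0,\dots,N-1$; (3) set $U^{(\ell+1)}_{h\tau}=U^{(\ell)}_{h\tau}-\frac1\kappa[U^{(\ell)}_{h\tau}-Y^{(\ell)}_{h\tau}]$. *)

(* Defs.v *)
From HB Require Import structures.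
From mathcomp Require Import all_boot all_order all_algebra.
From mathcomp Require Import all_classical all_reals all_analysis.
Set Implicit Arguments.
Unset Strict Implicit.
Unset Printing Implicit Defensive.
Import Order.TTheory GRing.Theory Num.Theory.
Import numFieldNormedType.Exports.
Local Open Scope classical_set_scope.
Local Open Scope ring_scope.

(* Finite element space V_h, represented in a nodal basis as 'cV[R]_m.       *)
(*   M : mass matrix      (u,v)_{L^2}          = u^T M v                     *)
(*   S : stiffness matrix (grad u, grad v)_L^2 = u^T S v  (H^1_0 product)    *)

(* quadratic form v^T A v ; with A = M it is ||v||_{L^2}^2, with A = S it is
   ||v||_{H^1_0}^2 = ||grad v||_{L^2}^2 *)
Definition qf {R : realType} {m : nat} (A : 'M[R]_m) (v : 'cV[R]_m) : R :=
  (v^T *m A *m v) 0 0.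

Definition SPD {R : realType} {m : nat} (A : 'M[R]_m) : Prop :=
  A^T = A /\ forall v : 'cV[R]_m, v != 0 -> 0 < qf A v.

(* discrete Laplacian: (-Delta_h xi, phi)_{L^2} = (grad xi, grad phi)_{L^2},
   i.e. M (-Delta_h) = S *)
Definition Deltah {R : realType} {m : nat} (M S : 'M[R]_m) : 'M[R]_m :=
  - (invmx M *m S).

Definition A0 {R : realType} {m : nat} (M S : 'M[R]_m) (tau : R) : 'M[R]_m :=
  invmx (1%:M - tau *: Deltah M S).

Definition G_measurable {d} {Om : measurableType d} {R : realType}
  (G : set (set Om)) (f : Om -> R) : Prop :=
  forall B : set R, measurable B -> G (f @^-1` B).

Definition vG_measurable {d} {Om : measurableType d} {R : realType} {m : nat}
  (G : set (set Om)) (X : Om -> 'cV[R]_m) : Prop :=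
  forall i : 'I_m, G_measurable G (fun w => X w i 0).

Definition increment {d} {Om : measurableType d} {R : realType}
  (W : R -> Om -> R) (s t : R) : Om -> R := fun w => W t w - W s w.

Definition is_wiener_process {d} {Om : measurableType d} {R : realType}
  (P : probability Om R) (T : R) (W : R -> Om -> R) : Prop :=
  [/\ (forall t, measurable_fun setT (W t)),
      {ae P, forall w, W 0 w = 0},
      {ae P, forall w, {within `[0, T], continuous (fun t => W t w)}},
      (forall s t, 0 <= s -> s < t -> t <= T -> forall B : set R, measurable B ->
         P (increment W s t @^-1` B) = normal_prob 0 (Num.sqrt (t - s)) B)
    & (forall (k : nat) (t : nat -> R), 0 <= t 0%N ->
         (forall i, (i < k)%N -> t i < t i.+1) -> t k <= T ->
         forall B : nat -> set R, (forall i, measurable (B i)) ->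
         fine (P (\bigcap_(i in `I_k) (increment W (t i) (t i.+1) @^-1` B i))) =
         \prod_(i < k) fine (P (increment W (t i) (t i.+1) @^-1` B i)))].

Definition aug_nat_filtration {d} {Om : measurableType d} {R : realType}
  (P : probability Om R) (W : R -> Om -> R) (t : R) : set (set Om) :=
  <<s [set A | exists s, 0 <= s <= t /\
                 exists B : set R, measurable B /\ A = W s @^-1` B]
      `|` [set N | measurable N /\ P N = 0%E] >>.

Definition cond_exp {d} {Om : measurableType d} {R : realType} {m : nat}
  (P : probability Om R) (G : set (set Om)) (X Y : Om -> 'cV[R]_m) : Prop :=
  vG_measurable G Y /\
  forall i : 'I_m,
    [/\ P.-integrable setT (fun w => (X w i 0)%:E),
        P.-integrable setT (fun w => (Y w i 0)%:E)
      & forall A, G A ->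
          (\int[P]_(w in A) (Y w i 0)%:E = \int[P]_(w in A) (X w i 0)%:E)%E].

Definition Expe {d} {Om : measurableType d} {R : realType}
  (P : probability Om R) (f : Om -> R) : \bar R := (\int[P]_w (f w)%:E)%E.

(* Discrete processes: a process is n |-> X(t_n)                            *)

Definition dW {d} {Om : measurableType d} {R : realType}
  (W : R -> Om -> R) (tau : R) (k : nat) : Om -> R :=
  fun w => W (k%:R * tau) w - W (k.-1%:R * tau) w.

Definition normU2 {d} {Om : measurableType d} {R : realType} {m : nat}
  (P : probability Om R) (M : 'M[R]_m) (N : nat) (tau : R)
  (U : nat -> Om -> 'cV[R]_m) : \bar R :=
  (tau%:E * \sum_(n < N) Expe P (fun w => qf M (U n w)))%E.

Definition normX2 {d} {Om : measurableType d} {R : realType} {m : nat}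
  (P : probability Om R) (M : 'M[R]_m) (N : nat) (tau : R)
  (X : nat -> Om -> 'cV[R]_m) : \bar R :=
  (tau%:E * \sum_(n < N) Expe P (fun w => qf M (X n.+1 w)))%E.

Definition in_Uht {d} {Om : measurableType d} {R : realType} {m : nat}
  (P : probability Om R) (M : 'M[R]_m) (F : nat -> set (set Om)) (N : nat)
  (U : nat -> Om -> 'cV[R]_m) : Prop :=
  forall n, (n < N)%N ->
    vG_measurable (F n) (U n) /\ (Expe P (fun w => qf M (U n w)) < +oo)%E.

(* control-to-state map S_{h tau}:
   [1 - tau Delta_h] X(t_{n+1}) = X(t_n) + tau U(t_n) + [X(t_n) + sig_n] Delta_{n+1} W,
   X(0) = x0 ; here x0 = R_h X_0 and sig n = R_h sigma(t_n). *)
Fixpoint stateh {d} {Om : measurableType d} {R : realType} {m : nat}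
  (M S : 'M[R]_m) (tau : R) (W : R -> Om -> R) (x0 : 'cV[R]_m)
  (sig : nat -> 'cV[R]_m) (U : nat -> Om -> 'cV[R]_m) (n : nat) : Om -> 'cV[R]_m :=
  match n with
  | 0%N => fun _ => x0
  | k.+1 => fun w =>
      A0 M S tau *m (stateh M S tau W x0 sig U k w + tau *: U k w
                     + dW W tau k.+1 w *: (stateh M S tau W x0 sig U k w + sig k))
  end.

Definition Jtau {d} {Om : measurableType d} {R : realType} {m : nat}
  (P : probability Om R) (M : 'M[R]_m) (N : nat) (tau alpha : R)
  (X U : nat -> Om -> 'cV[R]_m) : \bar R :=
  ((2^-1)%:E * (normX2 P M N tau X + normU2 P M N tau U)
   + (alpha / 2)%:E * Expe P (fun w => qf M (X N w)))%E.

Definition Jhat {d} {Om : measurableType d} {R : realType} {m : nat}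
  (P : probability Om R) (M S : 'M[R]_m) (N : nat) (tau alpha : R)
  (W : R -> Om -> R) (x0 : 'cV[R]_m) (sig : nat -> 'cV[R]_m)
  (U : nat -> Om -> 'cV[R]_m) : \bar R :=
  Jtau P M N tau alpha (stateh M S tau W x0 sig U) U.

Definition Lop {d} {Om : measurableType d} {R : realType} {m : nat}
  (M S : 'M[R]_m) (tau : R) (W : R -> Om -> R)
  (U : nat -> Om -> 'cV[R]_m) (n : nat) : Om -> 'cV[R]_m :=
  fun w => tau *: \sum_(j < n)
     ((\prod_(j.+2 <= k < n.+1) (1 + dW W tau k w)) *: (A0 M S tau ^+ (n - j) *m U j w)).

(* random variable whose F_{t_j}-conditional expectation is (L^* X)(t_j):
   tau sum_{n=j+1}^{N} A_0^{n-j} prod_{k=j+2}^{n} (1 + Delta_k W) X(t_n) *)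
Definition Lstar_inner {d} {Om : measurableType d} {R : realType} {m : nat}
  (M S : 'M[R]_m) (N : nat) (tau : R) (W : R -> Om -> R)
  (X : nat -> Om -> 'cV[R]_m) (j : nat) : Om -> 'cV[R]_m :=
  fun w => tau *: \sum_(j.+1 <= n < N.+1)
     ((\prod_(j.+2 <= k < n.+1) (1 + dW W tau k w)) *: (A0 M S tau ^+ (n - j) *m X n w)).

(* random variable whose F_{t_j}-conditional expectation is (\hat L^* x)(t_j):
   A_0^{N-j} prod_{k=j+2}^{N} (1 + Delta_k W) x *)
Definition Lhatstar_inner {d} {Om : measurableType d} {R : realType} {m : nat}
  (M S : 'M[R]_m) (N : nat) (tau : R) (W : R -> Om -> R)
  (x : Om -> 'cV[R]_m) (j : nat) : Om -> 'cV[R]_m :=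
  fun w => (\prod_(j.+2 <= k < N.+1) (1 + dW W tau k w)) *: (A0 M S tau ^+ (N - j) *m x w).

(* K = || 1 + L^* L + alpha \hat L^* \hat L ||_{L(U_{h tau}; U_{h tau})} <= kappa,
   written out: || (1 + L^*L + alpha \hat L^* \hat L) U || <= kappa || U ||
   for all U in U_{h tau} (norms squared, kappa >= 0). *)
Definition hessian_norm_le {d} {Om : measurableType d} {R : realType} {m : nat}
  (P : probability Om R) (M S : 'M[R]_m) (F : nat -> set (set Om)) (N : nat)
  (tau alpha : R) (W : R -> Om -> R) (kappa : R) : Prop :=
  forall U : nat -> Om -> 'cV[R]_m, in_Uht P M F N U ->
  forall Y1 Y2 : nat -> Om -> 'cV[R]_m,
    (forall j, (j < N)%N ->
       cond_exp P (F j) (Lstar_inner M S N tau W (Lop M S tau W U) j) (Y1 j) /\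
       cond_exp P (F j) (Lhatstar_inner M S N tau W (Lop M S tau W U N) j) (Y2 j)) ->
    (normU2 P M N tau (fun j w => (U j w + Y1 j w + alpha *: Y2 j w)%R)
       <= (kappa ^+ 2)%:E * normU2 P M N tau U)%E.

Definition gd_step {d} {Om : measurableType d} {R : realType} {m : nat}
  (P : probability Om R) (M S : 'M[R]_m) (F : nat -> set (set Om)) (N : nat)
  (tau alpha kappa : R) (W : R -> Om -> R) (x0 : 'cV[R]_m)
  (sig : nat -> 'cV[R]_m) (U Unext : nat -> Om -> 'cV[R]_m) : Prop :=
  let X := stateh M S tau W x0 sig U in
  forall n, (n < N)%N ->
    exists Y1 Y2 : Om -> 'cV[R]_m,
      [/\ cond_exp P (F n) (Lstar_inner M S N tau W X n) Y1,
          cond_exp P (F n) (Lhatstar_inner M S N tau W (X N) n) Y2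
        & forall w, Unext n w = U n w - kappa^-1 *: (U n w - (- Y1 w - alpha *: Y2 w))].

(* Main.v *)
(* Write u_l = U^(l) - U^*, H for the Hessian 1 + L^*L + alpha \hat L^* \hat L and
   g_l = kappa (U^(l) - U^(l+1)). Testing the conditional expectations Y^(l) against adapted square
   integrable controls and subtracting the optimality condition of U^* gives g_l = H u_l, so the
   iteration is u_(l+1) = u_l - H u_l / kappa. From 1 <= H <= kappa one gets
   |H u|^2 <= kappa <H u, u>, hence |u_(l+1)|^2 <= |u_l|^2 - <H u_l, u_l> / kappa, with <H u_l, u_l>
   nonincreasing in l; as J(U^(l)) - min J = <H u_l, u_l> / 2, this yields (i) and, after summation,
   (ii). The bound (iii) is the discrete energy estimate for the linear recursion satisfied by
   X^(l) - X^* = L u_l, followed by Gronwall's inequality. The only stochastic input is the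
   independence of F_(t_n) and Delta_(n+1) W, together with E(1 + Delta W)^2 <= 1 + 16 tau. *)
Require Import Defs.
From HB Require Import structures.
From mathcomp Require Import all_boot all_order all_algebra.
From mathcomp Require Import all_classical all_reals all_analysis.
From mathcomp Require Import finmap measurable_realfun ring lra.
Import Order.TTheory GRing.Theory Num.Theory.
Import numFieldNormedType.Exports.
Local Open Scope classical_set_scope.
Local Open Scope ring_scope.

(** * Moments of the centered normal law *)

(** The Hessian is never formed as an operator: its quadratic form is [costform] at pairs (L u, u),
    and adjoints enter only through pairings with adapted test controls, so the conditional
    expectations that occur are those supplied by the algorithm. Accordingly the norm bound is
    applied only in the directions g_l, where it yields <H g_l, g_l> <= kappa |g_l|^2. The
    inequality |H u_l|^2 <= kappa <H u_l, u_l> is then read off from <H u_(l+1), u_(l+1)> >= 0,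
    without spectral calculus. A second obstacle is integrability. The adjoint integrands multiply
    the state by factors 1 + Delta_k W that are correlated with it, so they are merely integrable.
    In a pairing these factors are therefore regrouped with the test control, of which they are
    independent; that product stays square integrable. *)

Section gaussian_moments.
Context {R : realType}.
Local Notation mu := (@lebesgue_measure R).

Lemma normal_peak2 (s : R) : 0 < s -> normal_peak s = 2 * normal_peak (2 * s).
Proof.
move=> s0; rewrite /normal_peak.
have -> : (2 * s) ^+ 2 * pi *+ 2 = 2 ^+ 2 * (s ^+ 2 * pi *+ 2) by ring.
rewrite sqrtrM ?sqrtr_sqr ?exprn_ge0// (@ger0_norm _ 2)// invfM mulrA divff ?mul1r//.
Qed.

(* With y = x^2/(8 s^2): y e^(-4y) <= e^(-y). *)
Lemma sqr_normal_pdf_le (s x : R) : 0 < s ->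
  x ^+ 2 * normal_pdf 0 s x <= 16 * s ^+ 2 * normal_pdf 0 (2 * s) x.
Proof.
move=> s0; have s2 : 0 < 2 * s by rewrite mulr_gt0.
rewrite !normal_pdfE ?gt_eqF// (normal_peak2 s)// /normal_fun subr0.
pose y := x ^+ 2 / (8 * s ^+ 2).
have y0 : 0 <= y by rewrite divr_ge0 ?sqr_ge0// mulr_ge0// sqr_ge0.
have s2n : s ^+ 2 != 0 by rewrite expf_neq0// gt_eqF.
have -> : - x ^+ 2 / (s ^+ 2 *+ 2) = - y + - (3 * y) by rewrite /y; field; rewrite gt_eqF.
have -> : - x ^+ 2 / ((2 * s) ^+ 2 *+ 2) = - y.
  by rewrite /y; field; rewrite gt_eqF.
have xE : x ^+ 2 = 8 * s ^+ 2 * y by rewrite /y; field; rewrite gt_eqF.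
rewrite xE expRD.
have H : y * expR (- (3 * y)) <= 1.
  rewrite expRN ler_pdivrMr ?expR_gt0// mul1r.
  by apply: le_trans (expR_ge1Dx _); nra.
(* The constant 16 is 8, from x^2 = 8 s^2 y, times 2, the ratio of the peaks; the leftover factor y
   e^(-3y) is at most 1. *)
have -> : 8 * s ^+ 2 * y * (2 * normal_peak (2 * s) * (expR (- y) * expR (- (3 * y))))
  = (16 * s ^+ 2 * (normal_peak (2 * s) * expR (- y))) * (y * expR (- (3 * y))) by ring.
apply: ler_piMr => //.
by rewrite !mulr_ge0 ?normal_peak_ge0 ?expR_ge0 ?(ltW s0).
Qed.

(** Change of variables is available for the Radon-Nikodym derivative; it equals the explicit
    density almost everywhere because both have the same integral over every measurable set. *)
Lemma ge0_integral_normal (s : R) (f : R -> \bar R) : measurable_fun setT f ->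
  (forall x, 0 <= f x)%E ->
  (\int[normal_prob 0 s]_x f x = \int[mu]_x (f x * (normal_pdf 0 s x)%:E))%E.
Proof.
move=> mf f0.
have dom := @normal_prob_dominates R 0 s.
rewrite -(Radon_Nikodym_SigmaFinite.change_of_variables dom)//.
have fint := Radon_Nikodym_SigmaFinite.f_integrable dom.
apply: ae_eq_integral => //.
- apply: emeasurable_funM => //; exact: (measurable_int mu).
- apply: emeasurable_funM => //; apply/measurable_EFinP; exact: measurable_normal_pdf.
- apply: ae_eqe_mul2l; apply: integral_ae_eq => //.
  + by apply/measurable_EFinP; exact: measurable_normal_pdf.
  + by move=> E _ mE; rewrite -Radon_Nikodym_SigmaFinite.f_integral.
Qed.

Lemma ge0_integralN (f : R -> \bar R) : measurable_fun setT f ->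
  (forall x, 0 <= f x)%E -> (\int[mu]_x f x = \int[mu]_x f (- x)%R)%E.
Proof.
move=> mf f0.
transitivity (\int[pushforward mu (-%R : _ -> measurableTypeR R)]_x f x)%E.
  by apply: eq_measure_integral => //= A mA AS; exact/esym/lebesgue_measureN.
by rewrite ge0_integral_pushforward.
Qed.

(** Comparison with a Gaussian of doubled deviation, whose mass is one, replaces integration by
    parts; for the time stepping only the order s^2 counts. *)
Lemma normal_second_moment_le (s : R) : 0 < s ->
  (\int[normal_prob 0 s]_x (x ^+ 2)%:E <= (16 * s ^+ 2)%:E)%E.
Proof.
move=> s0.
rewrite ge0_integral_normal//; last 2 first.
- by apply/measurable_EFinP; exact: measurable_funX.
- by move=> x; rewrite lee_fin sqr_ge0.
have := @integral_normal_pdf R 0 (2 * s).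
move=> I; rewrite -[leRHS]mule1 -I -ge0_integralZl//; last 3 first.
- by apply/measurable_EFinP; exact: measurable_normal_pdf.
- by move=> x _; rewrite lee_fin normal_pdf_ge0.
- by rewrite lee_fin mulr_ge0 ?sqr_ge0.
apply: ge0_le_integral => //.
- by move=> x _; rewrite -EFinM lee_fin mulr_ge0 ?sqr_ge0 ?normal_pdf_ge0.
- apply/measurable_EFinP/measurable_funM; [exact: measurable_funX|exact: measurable_normal_pdf].
- by apply/measurable_EFinP/measurable_funM => //; exact: measurable_normal_pdf.
- by move=> x _; rewrite -!EFinM lee_fin sqr_normal_pdf_le.
Qed.

(* (1 + x)^2 + 2 x^- = 1 + x^2 + 2 x^+, and x^+, x^- have the same integral by symmetry. *)
Lemma normal_sqr1D_le (s : R) : 0 < s ->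
  (\int[normal_prob 0 s]_x ((1 + x) ^+ 2)%:E <= (1 + 16 * s ^+ 2)%:E)%E.
Proof.
move=> s0; set nu := normal_prob 0 s.
pose p (x : R) := Num.max x 0; pose n (x : R) := Num.max (- x) 0.
have p0 x : 0 <= p x by rewrite le_max lexx orbT.
have n0 x : 0 <= n x by rewrite le_max lexx orbT.
have mp : measurable_fun setT p by exact: measurable_maxr.
have mn : measurable_fun setT n by apply: measurable_maxr => //; exact: oppr_measurable.
have mx2 : measurable_fun setT (fun x : R => x ^+ 2) by exact: measurable_funX.
have pn : (\int[nu]_x (p x)%:E = \int[nu]_x (n x)%:E)%E.
  rewrite !ge0_integral_normal//; try exact/measurable_EFinP.
  rewrite ge0_integralN//; last 2 first.
  - by apply/measurable_EFinP/measurable_funM => //; exact: measurable_normal_pdf.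
  - by move=> x; rewrite -EFinM lee_fin mulr_ge0// normal_pdf_ge0.
  apply: eq_integral => x _; congr (_ * _%:E)%E.
  by rewrite !normal_pdfE ?gt_eqF// /normal_fun !subr0 sqrrN.
have E2 := normal_second_moment_le s s0.
(* Finiteness is what allows this integral to be added to both sides and cancelled in the extended
   reals; it follows from 2 x^- <= 1 + x^2. *)
have nfin : (\int[nu]_x (2 * n x)%:E \is a fin_num)%E.
  rewrite ge0_fin_numE; last by apply: integral_ge0 => x _; rewrite lee_fin mulr_ge0.
  apply: (@le_lt_trans _ _ (\int[nu]_x (1%:E + (x ^+ 2)%:E))%E).
    apply: ge0_le_integral => //.
    - by move=> x _; rewrite lee_fin mulr_ge0.
    - by apply/measurable_EFinP/measurable_funM.
    - by apply/measurable_EFinP/measurable_funD.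
    move=> x _; rewrite -EFinD lee_fin /n; have := sqr_ge0 (1 + x); have := sqr_ge0 x.
    by move=> q1 q2; case: (leP (- x) 0) => h; nra.
  rewrite ge0_integralD//; last 2 first.
    by move=> x _; rewrite lee_fin sqr_ge0.
    exact/measurable_EFinP.
  rewrite integral_cst// [X in (_ * X)%E]probability_setT mule1.
  by apply: (@le_lt_trans _ _ (1 + (16 * s ^+ 2)%:E)%E); rewrite ?leeD2l// -EFinD ltry.
rewrite -(leeD2rE _ _ nfin).
have pnE : (\int[nu]_x (2 * p x)%:E = \int[nu]_x (2 * n x)%:E)%E.
  under eq_integral do rewrite EFinM.
  under [RHS]eq_integral do rewrite EFinM.
  rewrite !ge0_integralZl// ?pn//; try exact/measurable_EFinP; try by move=> x _; rewrite lee_fin.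
have mEp : measurable_fun setT (fun x : R => (2 * p x)%:E) by apply/measurable_EFinP/measurable_funM.
have mEn : measurable_fun setT (fun x : R => (2 * n x)%:E) by apply/measurable_EFinP/measurable_funM.
have m1 : measurable_fun setT (fun x : R => ((1 + x) ^+ 2)%:E).
  by apply/measurable_EFinP/measurable_funX/measurable_funD.
rewrite -ge0_integralD//; last 2 first.
- by move=> x _; rewrite lee_fin sqr_ge0.
- by move=> x _; rewrite lee_fin mulr_ge0.
rewrite [X in (integral _ _ X <= _)%E](_ : _ = (fun x : R => 1%:E + (x ^+ 2)%:E + (2 * p x)%:E)%E); last first.
  apply/funext => x; rewrite -!EFinD; congr _%:E; rewrite /p /n.
  by case: (leP x 0) => h1; case: (leP (- x) 0) => h2; try ring; nra.
rewrite ge0_integralD//; last 3 first.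
- by move=> x _; rewrite -EFinD lee_fin addr_ge0 ?sqr_ge0.
- by apply/measurable_EFinP/measurable_funD.
- by move=> x _; rewrite lee_fin mulr_ge0.
rewrite pnE leeD2r// ge0_integralD//; last 2 first.
- by move=> x _; rewrite lee_fin sqr_ge0.
- exact/measurable_EFinP.
by rewrite integral_cst// [X in (_ * X)%E]probability_setT mule1 EFinD leeD2l.
Qed.

End gaussian_moments.

(** * Independence of Wiener increments from the past *)

Section independence.
Context {d} {Om : measurableType d} {R : realType} (P : probability Om R).

Lemma probability_eq_outside_null (N X Y : set Om) :
  measurable N -> P N = 0%E -> measurable X -> measurable Y ->
  X `\` N = Y `\` N -> P X = P Y.
Proof.
move=> mN N0 mX mY XY.
have H Z : measurable Z -> P Z = P (Z `\` N).
  move=> mZ; rewrite (measureDI P mZ mN) [X in (_ + X)%E](_ : _ = 0%E) ?adde0//.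
  by apply: (subset_measure0 _ mN) => //; exact: measurableI.
by rewrite H// XY -H.
Qed.

(** Both A |-> P(A [&] E) and A |-> P(A) P(E) are finite measures, so agreement on the pi-system [G]
    propagates to the sigma-algebra it generates. *)
Lemma indep_sigma_algebra (G : set (set Om)) (E : set Om) :
  G `<=` measurable -> setI_closed G -> G setT -> measurable E ->
  (forall A, G A -> P (A `&` E) = (P A * P E)%E) ->
  forall A, <<s G>> A -> P (A `&` E) = (P A * P E)%E.
Proof.
move=> Gm GI GT mE GE A sA.
have PE0 : 0 <= fine (P E) by apply: fine_ge0; exact: measure_ge0.
pose m1 := mrestr P mE; pose m2 := mscale (NngNum PE0) P.
have -> : P (A `&` E) = m1 A by [].
have m2E B : m2 B = (P B * P E)%E.
  by rewrite /m2 /mscale/= fineK ?fin_num_measure// muleC.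
rewrite -m2E.
apply: (g_sigma_algebra_measure_unique G Gm (fun=> setT)) => //.
- by rewrite bigcup_const.
- by move=> B GB; rewrite -[RHS]/(m2 B) m2E -GE.
- by move=> k; rewrite /= /m1 /mrestr setTI ltey_eq fin_num_measure.
Qed.

Section wiener.
Context {T : R} {W : R -> Om -> R} (wW : is_wiener_process P T W).

Let mW t : measurable_fun setT (W t).
Proof. by case: wW. Qed.

Lemma measurable_increment (s t : R) : measurable_fun setT (increment W s t).
Proof. exact: measurable_funB. Qed.

Definition increment_rectangles (m : nat) (t : nat -> R) : set (set Om) :=
  [set A | exists B : nat -> set R, (forall i, measurable (B i)) /\
     A = \bigcap_(i in `I_m) (increment W (t i) (t i.+1) @^-1` B i)].

Lemma measurable_increment_preimage (s t : R) (B : set R) :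
  measurable B -> measurable (increment W s t @^-1` B).
Proof.
by move=> mB; rewrite -[X in measurable X]setTI; exact: measurable_increment.
Qed.

Lemma increment_rectangles_measurable m t : increment_rectangles m t `<=` measurable.
Proof.
move=> _ [B [mB ->]]; apply: bigcap_measurableType => i _.
exact: measurable_increment_preimage.
Qed.

Lemma increment_rectanglesI m t : setI_closed (increment_rectangles m t).
Proof.
move=> _ _ [B [mB ->]] [C [mC ->]].
exists (fun i => B i `&` C i); split; first by move=> i; exact: measurableI.
by rewrite -bigcapI; apply: eq_bigcapr.
Qed.

Lemma increment_rectanglesT m t : increment_rectangles m t setT.
Proof.
exists (fun=> setT); split => //.
by apply/seteqP; split.
Qed.

(** The product formula for m + 1 increments is used twice: with last factor C, and with last factor
    the whole line, which identifies P(A) with the product of the first m probabilities. *)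
Lemma increment_rectangles_indep m t (C : set R) : 0 <= t 0%N ->
  (forall i, (i <= m)%N -> t i < t i.+1) -> t m.+1 <= T -> measurable C ->
  forall A, increment_rectangles m t A ->
  P (A `&` (increment W (t m) (t m.+1) @^-1` C)) =
  (P A * P (increment W (t m) (t m.+1) @^-1` C))%E.
Proof.
move=> t0 tinc tT mC _ [B [mB ->]].
case: wW => _ _ _ _ /(_ m.+1 t t0) ind.
have {}ind := ind (fun i => tinc i) tT.
set A := \bigcap_(i in _) _; set E := _ @^-1` C.
have mA : measurable A by apply: (increment_rectangles_measurable m t); exists B.
have mE : measurable E by exact: measurable_increment_preimage.
have H D : measurable D ->
    fine (P (A `&` (increment W (t m) (t m.+1) @^-1` D))) =
    (\prod_(i < m) fine (P (increment W (t i) (t i.+1) @^-1` B i))) *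
    fine (P (increment W (t m) (t m.+1) @^-1` D)).
  move=> mD; have := ind (fun i => if (i < m)%N then B i else D).
  rewrite big_ord_recr/= ltnn.
  under eq_bigr do rewrite ltn_ord.
  move=> <-.
  - congr (fine (P _)); apply/seteqP; split => [w [wA wD] i/=|w wA].
      rewrite ltnS leq_eqVlt => /orP[/eqP ->|im]; first by rewrite ltnn.
      by rewrite im; exact: wA.
    split => [i /= im|]; last by have /= := wA m; rewrite ltnn; apply.
    by have /= := wA i; rewrite im; apply; exact: ltnW.
  - by move=> i; case: ifP.
have HC := H C mC; have := H setT measurableT.
rewrite preimage_setT setIT probability_setT/= mulr1 => HA.
have fA : P A \is a fin_num by rewrite fin_num_measure.
have fE : P E \is a fin_num by rewrite fin_num_measure.
rewrite -(fineK fA) -(fineK fE) -EFinM HA -HC fineK// fin_num_measure//.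
exact: measurableI.
Qed.

(** Sorting 0, a and the given times without repetition yields a strictly increasing grid; for a = 0
    it degenerates to m = 0. *)
Lemma exists_time_grid (a : R) (s : seq R) : 0 <= a ->
  (forall x, x \in s -> 0 <= x <= a) ->
  exists (m : nat) (t : nat -> R),
  [/\ t 0%N = 0, t m = a, (forall i, (i < m)%N -> t i < t i.+1)
    & forall x, x \in s -> exists2 i, (i <= m)%N & t i = x].
Proof.
move=> a0 sa; pose g := sort <=%R (undup [:: 0, a & s]).
have gP x : (x \in g) = (x \in [:: 0, a & s]) by rewrite mem_sort mem_undup.
have ga x : x \in g -> 0 <= x <= a.
  by rewrite gP !inE => /or3P[/eqP ->|/eqP ->|/sa//]; rewrite ?lexx ?a0.
have sg : sorted <%R g by rewrite sort_lt_sorted undup_uniq.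
have g0 : (0 < size g)%N by have := gP 0; rewrite !inE eqxx; case: (g).
have nthg i : (i <= (size g).-1)%N -> nth 0 g i \in g.
  by move=> h; rewrite mem_nth// -(prednK g0).
have idx x : x \in g -> (index x g <= (size g).-1)%N.
  by rewrite -index_mem -{1}(prednK g0) ltnS.
have mono i j : (i <= j)%N -> (j <= (size g).-1)%N -> nth 0 g i <= nth 0 g j.
  move=> ij jg; rewrite lt_sorted_leq_nth// inE.
    by rewrite (leq_ltn_trans ij)// -(prednK g0).
  by rewrite -(prednK g0).
exists (size g).-1, (nth 0 g); split.
- apply/eqP; rewrite eq_le; have /andP[-> _] := ga _ (nthg 0%N isT).
  rewrite andbT -[leRHS](@nth_index _ 0 0 g); last by rewrite gP !inE eqxx.
  by apply: mono => //; apply: idx; rewrite gP !inE eqxx.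
- apply/eqP; rewrite eq_le; have /andP[_ ->] := ga _ (nthg _ (leqnn _)).
  have ag : a \in g by rewrite gP !inE eqxx orbT.
  by rewrite -[leLHS](@nth_index _ 0 a g)// mono// idx.
- move=> i im; rewrite lt_sorted_ltn_nth// inE.
    by rewrite (ltn_trans im)// -(prednK g0).
  by rewrite -(prednK g0) ltnS.
- move=> x xs; have xg : x \in g by rewrite gP !inE xs !orbT.
  by exists (index x g); [exact: idx|rewrite nth_index].
Qed.

Lemma measurable_seq_forall (G : set (set Om)) (s : seq R)
    (X : R -> Om -> R) (B : R -> set R) :
  (forall x, x \in s -> <<s G>> (X x @^-1` B x)) ->
  <<s G>> [set w | forall x, x \in s -> B x (X x w)].
Proof.
elim: s => [_|x s IH H].
  rewrite (_ : mkset _ = setT); last by apply/seteqP; split.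
  exact: (@measurableT _ (g_sigma_algebraType G)).
rewrite (_ : mkset _ = X x @^-1` B x `&` [set w | forall y, y \in s -> B y (X y w)]).
  apply: (@measurableI _ (g_sigma_algebraType G)); first by apply: H; rewrite mem_head.
  by apply: IH => y ys; apply: H; rewrite inE ys orbT.
apply/seteqP; split => [w Hw|w [Hx Hs] y].
  by split; [apply: Hw; rewrite mem_head|move=> y ys; apply: Hw; rewrite inE ys orbT].
by rewrite inE => /predU1P[->//|]; exact: Hs.
Qed.

Lemma aug_nat_filtration_measurable (t : R) : aug_nat_filtration P W t `<=` measurable.
Proof.
apply: smallest_sub; first exact: sigma_algebra_measurable.
move=> A [[s [_ [B [mB ->]]]]|[]//].
by rewrite -[X in measurable X]setTI; exact: mW.
Qed.

(* The generating pi-system consists of null sets and of events in finitely many W(s); up to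
   the null event W(0) <> 0 the latter are events in the increments along a time grid. *)
Lemma wiener_increment_indep (a b : R) (C : set R) (A : set Om) :
  0 <= a -> a < b -> b <= T -> measurable C ->
  aug_nat_filtration P W a A ->
  P (A `&` (increment W a b @^-1` C)) = (P A * P (increment W a b @^-1` C))%E.
Proof.
move=> a0 ab bT mC FA; set E := _ @^-1` C.
have mE : measurable E by exact: measurable_increment_preimage.
pose Q0 : set (set Om) := [set A | exists (s : seq R) (B : R -> set R),
  [/\ forall x, x \in s -> 0 <= x <= a, forall x, measurable (B x) &
    A = [set w | forall x, x \in s -> B x (W x w)]]].
pose Q : set (set Om) := Q0 `|` [set N | measurable N /\ P N = 0%E].
have mQ0 : Q0 `<=` measurable.
  move=> _ [s [B [_ mB ->]]].
  rewrite -(sigma_algebra_id (@sigma_algebra_measurable _ Om)).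
  apply: measurable_seq_forall => x _; apply: sub_sigma_algebra.
  by rewrite -[X in measurable X]setTI; exact: mW.
have mQ : Q `<=` measurable by move=> X [/mQ0//|[]].
have null_meas_sub X Y : measurable X -> measurable Y -> P X = 0%E ->
    measurable (X `&` Y) /\ P (X `&` Y) = 0%E.
  move=> mX mY X0; have mXY := measurableI _ _ mX mY.
  by split => //; apply: (subset_measure0 mXY mX) => //; exact: subIsetl.
apply: (@indep_sigma_algebra Q) => //; last 1 first.
- apply: sub_sigma_algebra2 FA => X [[s [sa [B [mB ->]]]]|]; last by right.
  left; exists [:: s], (fun=> B); split => //.
    by move=> x; rewrite inE => /eqP ->.
  apply/seteqP; split => [w Bw x|w]; first by rewrite inE => /eqP ->.
  by apply; rewrite mem_head.
- move=> X Y [QX|[mX X0]] QY; last first.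
    by right; apply: null_meas_sub => //; exact: mQ.
  case: QY => [QY|[mY Y0]]; last first.
    by right; rewrite setIC; apply: null_meas_sub => //; exact: mQ0.
  left; case: QX => s [B [sa mB ->]]; case: QY => s' [B' [sa' mB' ->]].
  exists (s ++ s'), (fun x => (if x \in s then B x else setT) `&`
                              (if x \in s' then B' x else setT)); split.
  + by move=> x; rewrite mem_cat => /orP[/sa|/sa'].
  + by move=> x; apply: measurableI; case: ifP.
  + apply/seteqP; split => [w [wB wB'] x _|w wBB].
      by split; case: ifPn => // xs; [exact: wB|exact: wB'].
    by split => x xs; have := wBB x; rewrite mem_cat xs ?orbT => /(_ isT) [].
- left; exists [::], (fun=> setT); split => //.
  by apply/seteqP; split.
- move=> {FA}A [QA|[mA A0]]; last first.
    by rewrite A0 mul0e; have [] := null_meas_sub _ _ mA mE A0.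
  have mA := mQ0 _ QA.
  case: QA => s [B [sa mB AE]].
  have [m [t [t0 tm tinc ts]]] := exists_time_grid a s a0 sa.
  have [N [mN N0 NW]] : P.-negligible (~` [set w | W 0 w = 0]) by case: wW.
  pose A' := [set w | forall x, x \in s -> B x (W x w - W 0 w)].
  (* [b] is appended after the grid point [t m] = a, so that [increment W a b] becomes the last of m
     + 1 consecutive increments. *)
  pose t' i := if (i <= m)%N then t i else b.
  pose G := increment_rectangles m t'.
  have sA' : <<s G>> A'.
    apply: (measurable_seq_forall G s (fun x w => W x w - W 0 w)) => x /ts[i im <-].
    (* W(t i) - W(0) telescopes into grid increments, each measurable for the sigma-algebra of the
       rectangles. *)
    suff H : measurable_fun setT (fun w : g_sigma_algebraType G => W (t i) w - W 0 w).
      by rewrite -[X in <<s _ >> X]setTI; exact: H.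
    elim: i im => [_|i IH im].
      by rewrite t0; under eq_fun do rewrite subrr; exact: measurable_cst.
    rewrite (_ : (fun _ => _) = (fun w : g_sigma_algebraType G =>
      (W (t i) w - W 0 w) + increment W (t i) (t i.+1) w)); last first.
      by apply/funext => w; rewrite /increment; ring.
    apply: measurable_funD; first by apply: IH; exact: ltnW.
    move=> _ D mD; rewrite setTI; apply: sub_sigma_algebra.
    exists (fun j => if j == i then D else setT); split; first by move=> j; case: ifP.
    apply/seteqP; split => [w wD j /= jm|w /(_ i im)/=]; last first.
      by rewrite eqxx /t' im (ltnW im).
    by case: eqP => // ->; rewrite /t' im (ltnW im).
  have mA' : measurable A'.
    by apply: smallest_sub sA'; [exact: sigma_algebra_measurable|
      exact: increment_rectangles_measurable].
  have AA' : A `\` N = A' `\` N.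
    apply/seteqP; split => w [wA wN]; split => //.
      have W0 : W 0 w = 0 by apply: contrapT => h; apply: wN; exact: NW.
      by move: wA; rewrite AE => wA x xs; rewrite W0 subr0; exact: wA.
    have W0 : W 0 w = 0 by apply: contrapT => h; apply: wN; exact: NW.
    by rewrite AE => x xs; have := wA _ xs; rewrite W0 subr0.
  rewrite (probability_eq_outside_null N A A')//.
  rewrite (probability_eq_outside_null N (A `&` E) (A' `&` E))//; last 3 first.
  + exact: measurableI.
  + exact: measurableI.
  + by rewrite !setDE -!setIA (setIC E) !setIA -!setDE AA'.
  have tE : increment W a b = increment W (t' m) (t' m.+1).
    by rewrite /t' leqnn ltnn tm.
  (* Second extension from a pi-system, now from the rectangles to the event A' in the
     increments. *)
  apply: (@indep_sigma_algebra G) sA' => //.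
  + exact: increment_rectangles_measurable.
  + exact: increment_rectanglesI.
  + exact: increment_rectanglesT.
  rewrite /E tE; apply: increment_rectangles_indep => //.
  + by rewrite /t' leq0n t0.
  + move=> i im; rewrite /t' im; case: ltnP => [|mi]; first exact: tinc.
    by have -> : i = m by [apply/eqP; rewrite eqn_leq im]; rewrite tm.
  + by rewrite /t' ltnn.
Qed.

End wiener.
End independence.

(** * Expectations of products of independent variables *)

Section product_moment.
Context {d} {Om : measurableType d} {R : realType} (P : probability Om R).

(** Independence makes the law of (Z, X) the product of the marginal laws, by uniqueness on
    rectangles; Tonelli then separates the integral. *)
Lemma Expe_mul_indep (Z X : Om -> R) (g : R -> R) :
  measurable_fun setT Z -> measurable_fun setT X -> measurable_fun setT g ->
  (forall w, 0 <= Z w) -> (forall x, 0 <= g x) ->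
  (forall A B, measurable A -> measurable B ->
     P ((Z @^-1` A) `&` (X @^-1` B)) = (P (Z @^-1` A) * P (X @^-1` B))%E) ->
  Expe P (fun w => Z w * g (X w)) = (Expe P Z * Expe P (fun w => g (X w)))%E.
Proof.
move=> mZ mX mg Z0 g0 ind; rewrite /Expe.
pose Zm := isMeasurableFun.Build _ _ _ _ _ mZ.
pose ZZ : {mfun Om >-> R} := HB.pack Z Zm.
pose Xm := isMeasurableFun.Build _ _ _ _ _ mX.
pose XX : {mfun Om >-> R} := HB.pack X Xm.
have mZX : measurable_fun setT (fun w => (Z w, X w)) by exact: measurable_fun_pair.
pose ZXm := isMeasurableFun.Build _ _ _ _ _ mZX.
pose ZX : {mfun Om >-> (R * R)%type} := HB.pack (fun w => (Z w, X w)) ZXm.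
(* The absolute value makes the integrand nonnegative on the whole plane, as Tonelli requires; it
   changes nothing on the range of Z. *)
pose f (p : R * R) : \bar R := (`|p.1| * g p.2)%:E.
have mnorm : measurable_fun setT (fun z : R => `|z|) by exact: normr_measurable.
have mf : measurable_fun setT f.
  apply/measurable_EFinP/measurable_funM.
  - by apply: measurableT_comp => //; exact: measurable_fst.
  - by apply: (measurableT_comp mg); exact: measurable_snd.
have f0 p : (0 <= f p)%E by rewrite lee_fin mulr_ge0.
transitivity (\int[distribution P ZX]_p f p)%E.
  rewrite (ge0_integral_distribution ZX)//.
  by apply: eq_integral => w _; rewrite /f/= ger0_norm.
transitivity (\int[(distribution P ZZ \x distribution P XX)%E]_p f p)%E.
  apply: eq_measure_integral => A mA _; apply/esym.
  apply: product_measure_unique mA => U V mU mV.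
  by rewrite /= /distribution /pushforward -ind.
rewrite fubini_tonelli1//.
transitivity (\int[distribution P ZZ]_x ((`|x|)%:E * \int[distribution P XX]_y (g y)%:E))%E.
  apply: eq_integral => x _; rewrite /fubini_F /f /=.
  under eq_integral do rewrite EFinM.
  rewrite ge0_integralZl//; first exact/measurable_EFinP.
  by move=> y _; rewrite lee_fin.
rewrite ge0_integralZr//; last 2 first.
- exact/measurable_EFinP.
- by apply: integral_ge0 => y _; rewrite lee_fin.
rewrite !ge0_integral_distribution//; try exact/measurable_EFinP.
by congr (_ * _)%E; apply: eq_integral => w _; rewrite /= ger0_norm.
Qed.

Lemma increment_sqr1D_le {T : R} {W : R -> Om -> R} (s t : R) :
  is_wiener_process P T W -> 0 <= s -> s < t -> t <= T ->
  (Expe P (fun w => ((1 + increment W s t w) ^+ 2)%R) <= (1 + 16 * (t - s))%:E)%E.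
Proof.
move=> wW s0 st tT; rewrite /Expe.
have mX : measurable_fun setT (increment W s t : Om -> measurableTypeR R).
  exact: measurable_increment wW s t.
pose Xm := isMeasurableFun.Build _ _ _ _ _ mX.
pose X : {mfun Om >-> measurableTypeR R} := HB.pack (increment W s t : Om -> measurableTypeR R) Xm.
have mf : measurable_fun setT (fun x : R => ((1 + x) ^+ 2)%:E).
  by apply/measurable_EFinP/measurable_funX/measurable_funD.
have -> : (\int[P]_w ((1 + increment W s t w) ^+ 2)%:E =
   \int[distribution P X]_x ((1 + x) ^+ 2)%:E)%E.
  by rewrite ge0_integral_distribution// => x; rewrite lee_fin sqr_ge0.
have -> : (\int[distribution P X]_x ((1 + x) ^+ 2)%:E =
  \int[normal_prob 0 (Num.sqrt (t - s))]_x ((1 + x) ^+ 2)%:E)%E.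
  apply: eq_measure_integral => A mA _; case: wW => _ _ _ law _.
  exact: law.
have ts : 0 < Num.sqrt (t - s) by rewrite sqrtr_gt0 subr_gt0.
have := normal_sqr1D_le _ ts.
by rewrite sqr_sqrtr// subr_ge0 ltW.
Qed.

End product_moment.

(** * Conditional expectations and square integrable adapted variables *)

Section square_integrable.
Import HBNNSimple.
Context {d} {Om : measurableType d} {R : realType} (P : probability Om R).

Section tower.
Variables (G : set (set Om)) (Gm : <<s G>> `<=` measurable).

Lemma G_measurableE (f : Om -> R) :
  G_measurable (<<s G>>) f <-> measurable_fun setT (f : g_sigma_algebraType G -> R).
Proof.
split => [H _ B mB|H B mB]; first by rewrite setTI; exact: H.
by rewrite -[X in <<s _ >> X]setTI; exact: H.
Qed.

Lemma G_measurable_measurable (f : Om -> R) :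
  G_measurable (<<s G>>) f -> measurable_fun setT f.
Proof. by move=> H _ B mB; rewrite setTI; apply: Gm; exact: H. Qed.

(** For a simple Z the integral is a combination of integrals of D over level sets, all zero;
    dominated convergence with bound |Z D| passes to the limit. *)
Let int_mul_ge0 (Z D : Om -> R) : G_measurable (<<s G>>) Z -> (forall w, 0 <= Z w) ->
  P.-integrable setT (EFin \o D) ->
  P.-integrable setT (fun w => (Z w * D w)%:E) ->
  (forall A, <<s G>> A -> (\int[P]_(w in A) (D w)%:E = 0)%E) ->
  (\int[P]_w (Z w * D w)%:E = 0)%E.
Proof.
move=> GZ Z0 iD iZD D0.
have mZ' : measurable_fun setT (fun w : g_sigma_algebraType G => (Z w)%:E).
  by apply/measurable_EFinP; exact/G_measurableE.
(* The approximation is taken on [g_sigma_algebraType G], so that level sets lie in the small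
   sigma-algebra, where D is known to integrate to zero. *)
pose zs := nnsfun_approx (@measurableT _ (g_sigma_algebraType G)) mZ'.
pose z n : Om -> R := zs n.
have mD : measurable_fun setT D by apply/measurable_EFinP; exact: measurable_int iD.
have mz n : measurable_fun setT (z n).
  by apply: G_measurable_measurable; apply/G_measurableE; exact: (measurable_funP (zs n)).
have iz n : (\int[P]_w (z n w * D w)%:E = 0)%E.
  have mzy (y : R) : <<s G>> (z n @^-1` [set y]).
    by rewrite -[X in <<s _ >> X]setTI; apply: (measurable_funP (zs n)).
  have iDy (y : R) : P.-integrable setT (fun w => (\1_(z n @^-1` [set y]) w * D w)%:E).
    apply: (le_integrable measurableT _ _ iD).
      apply/measurable_EFinP/measurable_funM => //; apply: measurable_indic; exact: (Gm _ (mzy y)).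
    move=> w _; rewrite lee_fin normrM ler_piMl// indicE.
    by case: (_ \in _); rewrite ?normr1// normr0.
  transitivity (\int[P]_w (\sum_(y <- fset_set (range (z n)))
     (y * (\1_(z n @^-1` [set y]) w * D w))%:E))%E.
    apply: eq_integral => w _; rewrite sumEFin; congr EFin.
    rewrite {1}/z (fimfunE (zs n)) fsbig_finite//= big_distrl/=.
    by apply: eq_bigr => y _; rewrite mulrA.
  rewrite integral_sum//; last first.
    by move=> y; have := integrableZl measurableT y (iDy y).
  apply: big1 => y _; under eq_integral do rewrite EFinM.
  rewrite integralZl//.
  rewrite [X in (_ * X)%E](_ : _ = 0%E) ?mule0// -(D0 _ (mzy y)) [RHS]integral_mkcond.
  apply: eq_integral => w _; rewrite patchE indicE.
  by case: (_ \in _); rewrite ?mul1r ?mul0r.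
have z_cvg w : (EFin \o z ^~ w) @ \oo --> (Z w)%:E.
  by apply: (@cvg_nnsfun_approx _ _ _ _ (@measurableT _ (g_sigma_algebraType G)) _ mZ') => // v _; rewrite lee_fin.
have zZ n w : `|z n w * D w| <= `|Z w * D w|.
  have z0 : 0 <= z n w by rewrite /z; apply: fun_ge0.
  rewrite !normrM ler_wpM2r// (ger0_norm z0) (ger0_norm (Z0 w)).
  by rewrite -lee_fin /z /zs nnsfun_approxE; apply: le_approx => // v _; rewrite lee_fin.
have [] := @dominated_convergence _ Om R P setT measurableT
  (fun n w => (z n w * D w)%:E) (fun w => (Z w * D w)%:E)
  (fun w => (`|Z w * D w|)%:E).
- by move=> n; apply/measurable_EFinP/measurable_funM.
- exact: measurable_int iZD.
- apply: aeW => w _; rewrite EFinM; under eq_fun do rewrite EFinM.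
  by apply: cvgeZr => //; exact: z_cvg.
- exact: integrable_norm.
- by apply: aeW => w n _; rewrite lee_fin zZ.
move=> _ _ /cvg_lim <-//.
rewrite [X in limn X](_ : _ = cst 0%E); first by rewrite lim_cst.
by apply/funext => n; rewrite /= iz.
Qed.

(** Meant for D = X - E[X | G]: a measurable factor may be paired with D as soon as Z D is
    integrable, with no square integrability asked of D. *)
Lemma G_measurable_mul_integral_eq0 (Z D : Om -> R) :
  G_measurable (<<s G>>) Z ->
  P.-integrable setT (EFin \o D) ->
  P.-integrable setT (fun w => (Z w * D w)%:E) ->
  (forall A, <<s G>> A -> (\int[P]_(w in A) (D w)%:E = 0)%E) ->
  (\int[P]_w (Z w * D w)%:E = 0)%E.
Proof.
move=> GZ iD iZD D0.
have mZ := proj1 (G_measurableE Z) GZ.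
pose p w := Num.max (Z w) 0; pose n w := Num.max (- Z w) 0.
have Gp : G_measurable (<<s G>>) p.
  by apply/G_measurableE; exact: measurable_maxr.
have Gn : G_measurable (<<s G>>) n.
  apply/G_measurableE; apply: measurable_maxr => //.
  exact: (measurableT_comp (@oppr_measurable _ _)).
have p0 w : 0 <= p w by rewrite le_max lexx orbT.
have n0 w : 0 <= n w by rewrite le_max lexx orbT.
have mD : measurable_fun setT D by apply/measurable_EFinP; exact: measurable_int iD.
have pZ w : `|p w| <= `|Z w|.
  by rewrite /p; case: (leP (Z w) 0); rewrite ?normr0.
have nZ w : `|n w| <= `|Z w|.
  by rewrite /n; case: (leP (- Z w) 0); rewrite ?normr0// normrN.
have ip : P.-integrable setT (fun w => (p w * D w)%:E).
  apply: (le_integrable measurableT _ _ iZD).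
    by apply/measurable_EFinP/measurable_funM => //; exact: G_measurable_measurable.
  by move=> w _; rewrite lee_fin !normrM ler_wpM2r.
have iN : P.-integrable setT (fun w => (n w * D w)%:E).
  apply: (le_integrable measurableT _ _ iZD).
    by apply/measurable_EFinP/measurable_funM => //; exact: G_measurable_measurable.
  by move=> w _; rewrite lee_fin !normrM ler_wpM2r.
transitivity (\int[P]_w ((p w * D w)%:E - (n w * D w)%:E))%E.
  apply: eq_integral => w _; rewrite -EFinB -mulrBl; congr (_ * _)%:E.
  by rewrite /p /n; case: (leP (Z w) 0); case: (leP (- Z w) 0); lra.
by rewrite integralB// !int_mul_ge0// subee.
Qed.

Definition L2 (f : Om -> R) : Prop :=
  G_measurable (<<s G>>) f /\ (Expe P (fun w => (f w ^+ 2)%R) < +oo)%E.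

Lemma L2_measurable f : L2 f -> measurable_fun setT f.
Proof. by case=> /G_measurable_measurable. Qed.

Lemma L2_sqr_integrable f : L2 f -> P.-integrable setT (fun w => (f w ^+ 2)%:E).
Proof.
move=> Lf; apply/integrableP; split.
  by apply/measurable_EFinP/measurable_funX; exact: L2_measurable.
case: Lf => _; rewrite /Expe; congr (_ < _)%E.
by apply: eq_integral => w _; rewrite /= ger0_norm ?sqr_ge0.
Qed.

Lemma L2_dom f g : G_measurable (<<s G>>) f ->
  P.-integrable setT (EFin \o g) -> (forall w, f w ^+ 2 <= g w) -> L2 f.
Proof.
move=> Gf ig fg; split => //.
have mf := G_measurable_measurable _ Gf.
apply: le_lt_trans (integrable_lty measurableT ig).
apply: ge0_le_integral => //.
- by move=> w _; rewrite lee_fin sqr_ge0.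
- by apply/measurable_EFinP/measurable_funX.
- exact: measurable_int ig.
- by move=> w _; rewrite lee_fin.
Qed.

Lemma L2_cst c : L2 (cst c).
Proof.
apply: (@L2_dom _ (cst (c ^+ 2))).
- by apply/G_measurableE; exact: measurable_cst.
- exact: finite_measure_integrable_cst.
- by move=> w.
Qed.

Lemma L2D f g : L2 f -> L2 g -> L2 (fun w => f w + g w).
Proof.
move=> Lf Lg; apply: (@L2_dom _ (fun w => 2 * f w ^+ 2 + 2 * g w ^+ 2)).
- by apply/G_measurableE; apply: measurable_funD; apply/G_measurableE; [case: Lf|case: Lg].
- have := integrableD measurableT (integrableZl measurableT 2 (L2_sqr_integrable f Lf))
    (integrableZl measurableT 2 (L2_sqr_integrable g Lg)).
  exact.
- by move=> w; have := sqr_ge0 (f w - g w); lra.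
Qed.

Lemma L2Z c f : L2 f -> L2 (fun w => c * f w).
Proof.
move=> Lf; apply: (@L2_dom _ (fun w => c ^+ 2 * f w ^+ 2)).
- by apply/G_measurableE; apply: measurable_funM => //; apply/G_measurableE; case: Lf.
- exact: (integrableZl measurableT (c ^+ 2) (L2_sqr_integrable f Lf)).
- by move=> w; rewrite exprMn.
Qed.

Lemma L2_sum (I : finType) (f : I -> Om -> R) : (forall i, L2 (f i)) ->
  L2 (fun w => \sum_i f i w).
Proof.
move=> Lf; elim: (index_enum I) => [|i s IH].
  by under eq_fun do rewrite big_nil; exact: L2_cst.
by under eq_fun do rewrite big_cons; exact: L2D.
Qed.

End tower.

Lemma L2_sub (G G' : set (set Om)) f : <<s G>> `<=` <<s G'>> -> L2 G f -> L2 G' f.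
Proof. by move=> GG' [Gf Ef]; split => // B mB; apply: GG'; exact: Gf. Qed.

Lemma L2_mul_integrable (G G' : set (set Om)) f g :
  <<s G>> `<=` measurable -> <<s G'>> `<=` measurable -> L2 G f -> L2 G' g ->
  P.-integrable setT (fun w => (f w * g w)%:E).
Proof.
move=> Gm Gm' Lf Lg.
have := integrableD measurableT (L2_sqr_integrable _ Gm _ Lf) (L2_sqr_integrable _ Gm' _ Lg).
apply: le_integrable => //.
  by apply/measurable_EFinP/measurable_funM; [exact: (L2_measurable G Gm)|exact: (L2_measurable G' Gm')].
move=> w _; rewrite lee_fin [leRHS]ger0_norm ?addr_ge0 ?sqr_ge0// ler_norml.
have := sqr_ge0 (f w - g w); have := sqr_ge0 (f w + g w).
have := sqr_ge0 (f w); have := sqr_ge0 (g w).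
by move=> *; apply/andP; split; lra.
Qed.

(** E(Z X)^2 = E Z^2 E X^2 by independence, so second moments alone keep products of noise factors
    square integrable. *)
Lemma L2_mul_indep (G G' : set (set Om)) (Z X : Om -> R) :
  <<s G>> `<=` measurable -> <<s G>> `<=` <<s G'>> ->
  L2 G Z -> G_measurable (<<s G'>>) X -> measurable_fun setT X ->
  (Expe P (fun w => (X w ^+ 2)%R) < +oo)%E ->
  (forall A B, <<s G>> A -> measurable B ->
     P (A `&` (X @^-1` B)) = (P A * P (X @^-1` B))%E) ->
  L2 G' (fun w => Z w * X w).
Proof.
move=> Gm GG' LZ GX mX EX ind; have [GZ EZ] := LZ.
split.
  apply/G_measurableE; apply: measurable_funM; apply/G_measurableE => //.
  by move=> B mB; apply: GG'; exact: GZ.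
have mZ := G_measurable_measurable _ Gm _ GZ.
under eq_fun do rewrite exprMn.
rewrite (@Expe_mul_indep _ _ _ P (fun w => Z w ^+ 2) X (fun x => x ^+ 2)).
- apply: lte_mul_pinfty => //.
    by apply: integral_ge0 => w _; rewrite lee_fin sqr_ge0.
  rewrite ge0_fin_numE//.
  by apply: integral_ge0 => w _; rewrite lee_fin sqr_ge0.
- exact: measurable_funX.
- exact: mX.
- exact: measurable_funX.
- by move=> w; rewrite sqr_ge0.
- by move=> w; rewrite sqr_ge0.
- move=> A B mA mB; apply: ind => //.
  have /G_measurableE mZ2 := GZ.
  by apply: (proj2 (G_measurableE G (fun w => Z w ^+ 2))) => //; exact: measurable_funX.
Qed.

End square_integrable.

(** * Finite element matrices and the difference equation *)

Section quadratic_forms.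
Context {R : realType} {m : nat}.
Implicit Types (A : 'M[R]_m) (u v x : 'cV[R]_m).

Definition bl A u v : R := (u^T *m A *m v) 0 0.

Lemma qfE A v : qf A v = bl A v v. Proof. by []. Qed.

Lemma blDl A u v x : bl A (u + v) x = bl A u x + bl A v x.
Proof. by rewrite /bl raddfD/= !mulmxDl mxE. Qed.

Lemma blZl A c u x : bl A (c *: u) x = c * bl A u x.
Proof. by rewrite /bl linearZ/= -!scalemxAl mxE. Qed.

Lemma blDr A u v x : bl A x (u + v) = bl A x u + bl A x v.
Proof. by rewrite /bl mulmxDr mxE. Qed.

Lemma blZr A c u x : bl A x (c *: u) = c * bl A x u.
Proof. by rewrite /bl -scalemxAr mxE. Qed.

Lemma bl_sumr A (I : Type) (r : seq I) (Q : pred I) (f : I -> 'cV[R]_m) x :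
  bl A x (\sum_(i <- r | Q i) f i) = \sum_(i <- r | Q i) bl A x (f i).
Proof.
apply: (big_morph (bl A x)); first by move=> u v; rewrite blDr.
by rewrite /bl mulmx0 mxE.
Qed.

Lemma bl_suml A (I : Type) (r : seq I) (Q : pred I) (f : I -> 'cV[R]_m) x :
  bl A (\sum_(i <- r | Q i) f i) x = \sum_(i <- r | Q i) bl A (f i) x.
Proof.
apply: (big_morph (bl A ^~ x)); first by move=> u v; rewrite blDl.
by rewrite /bl trmx0 !mul0mx mxE.
Qed.

Lemma bl_coordE A u v : bl A u v = \sum_i (A^T *m u) i 0 * v i 0.
Proof.
rewrite /bl mxE; apply: eq_bigr => i _; congr (_ * _).
by rewrite -[in LHS](trmxK A) -trmx_mul mxE.
Qed.

Lemma blC A u v : A^T = A -> bl A u v = bl A v u.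
Proof.
move=> AT; have -> : bl A u v = (u^T *m A *m v)^T 0 0 by rewrite mxE.
by rewrite !trmx_mul trmxK AT mulmxA.
Qed.

Lemma SPD_qf_ge0 A v : SPD A -> 0 <= qf A v.
Proof.
move=> [_ pos]; have [->|v0] := eqVneq v 0; last exact/ltW/pos.
by rewrite /qf mulmx0 mxE.
Qed.

Lemma SPD_unitmx A : SPD A -> A \in unitmx.
Proof.
move=> [AT pos]; rewrite -row_free_unit; apply: inj_row_free => u uA.
apply/eqP/negPn/negP => u0.
have := pos u^T; rewrite /qf trmxK uA mul0mx mxE ltxx.
by rewrite -(inj_eq (@trmx_inj _ _ _)) trmx0 trmxK u0 => /(_ isT).
Qed.

Lemma SPDD A B : SPD A -> SPD B -> SPD (A + B).
Proof.
move=> [AT Ap] [BT Bp]; split; first by rewrite raddfD/= AT BT.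
move=> v v0; rewrite qfE /bl mulmxDr mulmxDl mxE addr_gt0//; [exact: Ap|exact: Bp].
Qed.

Lemma SPDZ c A : 0 < c -> SPD A -> SPD (c *: A).
Proof.
move=> c0 [AT Ap]; split; first by rewrite linearZ/= AT.
by move=> v v0; rewrite /qf -scalemxAr -scalemxAl mxE mulr_gt0//; exact: Ap.
Qed.

(** The i-th coordinate is the A-product with the Riesz representer [y], so this is a Cauchy-Schwarz
    bound. *)
Lemma coord_le_qf A i : SPD A -> exists C : R, forall v, v i 0 ^+ 2 <= C * qf A v.
Proof.
move=> sA; have [AT _] := sA; have uA := SPD_unitmx _ sA.
pose y := invmx A *m delta_mx i (0 : 'I_1).
have yv v : bl A y v = v i 0.
  rewrite /bl trmx_mul trmx_inv AT mulmxKV// trmx_delta -rowE.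
  by rewrite mxE.
exists (1 + qf A y) => v.
pose q := qf A y; have q0 : 0 <= q := SPD_qf_ge0 _ _ sA.
(* The usual minimiser has 1/q in place of 1/(1 + q); the shift makes the division safe at the price
   of a slightly larger constant. *)
pose s := (1 + q)^-1; pose t := v i 0.
have := SPD_qf_ge0 _ (v + (- (s * t)) *: y) sA.
rewrite qfE blDl !blDr !blZl !blZr (blC _ v)// yv -!qfE -/t -/q => H.
have sq : s * (1 + q) = 1 by rewrite mulVf// gt_eqF// ltr_pwDl.
have s0 : 0 < s by rewrite invr_gt0 ltr_pwDl.
have {}H : s * t ^+ 2 <= qf A v.
  have := sqr_ge0 (s * t); nra.
by rewrite -(ler_pM2l s0) [leRHS]mulrA sq mul1r.
Qed.

End quadratic_forms.

(** * The implicit Euler resolvent *)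

Section resolvent.
Context {R : realType} {m : nat}.
Variables (M S : 'M[R]_m) (tau : R).
Hypotheses (sM : SPD M) (sS : SPD S) (tau0 : 0 < tau).

Lemma SPD_energy : SPD (M + tau *: S).
Proof. by apply: SPDD => //; exact: SPDZ. Qed.

(** Weak form of the resolvent: M (1 - tau Delta_h) = M + tau S, hence A0 = (M + tau S)^(-1) M. *)
Lemma A0E : (M + tau *: S) *m A0 M S tau = M.
Proof.
have uM := SPD_unitmx _ sM; have uK := SPD_unitmx _ SPD_energy.
have KE : M + tau *: S = M *m (1%:M - tau *: Deltah M S).
  by rewrite /Deltah mulmxBr mulmx1 scalerN mulmxN opprK -scalemxAr mulKVmx.
rewrite /A0 {1}KE mulmxK//.
by move: uK; rewrite KE unitmx_mul => /andP[].
Qed.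

(** M A0 = M (M + tau S)^(-1) M is symmetric, so A0 and its powers are self-adjoint in the discrete
    L^2 product. *)
Lemma A0_adjoint k u v : bl M (A0 M S tau ^+ k *m u) v = bl M u (A0 M S tau ^+ k *m v).
Proof.
set A := A0 M S tau; have [MT _] := sM; have [KT _] := SPD_energy.
have H1 : A^T *m M = M *m A.
  have E : A^T *m (M + tau *: S) = M by rewrite -[LHS]trmxK trmx_mul trmxK KT A0E MT.
  by rewrite -{1}A0E mulmxA E.
have H : (A ^+ k)^T *m M = M *m A ^+ k.
  elim: k => [|k IH]; first by rewrite expr0 trmx1 mul1mx mulmx1.
  by rewrite {1}exprSr exprS -!mulmxE trmx_mul -mulmxA IH mulmxA H1 mulmxA.
by rewrite /bl trmx_mul -!mulmxA (mulmxA _ M) H !mulmxA.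
Qed.

(* Test the implicit Euler step (M + tau S) e = M f with e and use 2 (e, f)_M <= |e|_M^2 + |f|_M^2. *)
Lemma A0_energy f :
  qf M (A0 M S tau *m f) + 2 * tau * qf S (A0 M S tau *m f) <= qf M f.
Proof.
set e := _ *m f; have [MT _] := sM.
have E : qf M e + tau * qf S e = bl M e f.
  have -> : bl M e f = bl (M + tau *: S) e e by rewrite /bl /e -!mulmxA (mulmxA _ (A0 _ _ _)) A0E.
  by rewrite /qf /bl mulmxDr mulmxDl -scalemxAr -scalemxAl [RHS]mxE; congr (_ + _); rewrite [RHS]mxE.
have := SPD_qf_ge0 _ (e + (-1) *: f) sM.
rewrite qfE blDl !blDr !blZl !blZr (blC M f)// -!qfE; lra.
Qed.

End resolvent.

(** * The linearised difference equation *)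

Section linear_recursion.
Context {d} {Om : measurableType d} {R : realType} {m : nat}.
Variables (M S : 'M[R]_m) (tau : R) (W : R -> Om -> R).
Implicit Types (u v : nat -> Om -> 'cV[R]_m).
Local Notation A := (A0 M S tau).
Local Notation L := (Lop M S tau W).

Definition xi (k : nat) (w : Om) : R := 1 + dW W tau k w.
(** The product starts at j + 2 because U(t_j) enters the step to t_(j+1) without a noise factor. *)
Definition prodxi (j n : nat) (w : Om) : R := \prod_(j.+2 <= k < n.+1) (1 + dW W tau k w).

Lemma prodxiSS j w : prodxi j j.+1 w = 1.
Proof. by rewrite /prodxi big_geq. Qed.

Lemma prodxiS j n w : (j < n)%N -> prodxi j n.+1 w = prodxi j n w * xi n.+1 w.
Proof. by move=> jn; rewrite /prodxi big_nat_recr. Qed.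

Lemma Lop0 u w : L u 0 w = 0.
Proof. by rewrite /Lop big_ord0 scaler0. Qed.

(** The closed formula for L solves the state recursion with zero initial value and zero sigma;
    later estimates use only this recursion. *)
Lemma LopS u n w : L u n.+1 w = A *m (xi n.+1 w *: L u n w + tau *: u n w).
Proof.
rewrite /Lop -/(xi n.+1 w) big_ord_recr/= big_geq// scale1r subSnn expr1.
rewrite scalerDr mulmxDr -!scalemxAr; congr (_ + _).
rewrite [RHS]scalerA [X in _ = X *: _]mulrC -[RHS]scalerA; congr (_ *: _).
rewrite mulmx_sumr scaler_sumr; apply: eq_bigr => j _.
rewrite -/(prodxi j n.+1 w) prodxiS// -/(prodxi j n w) -scalemxAr scalerA mulrC; congr (_ *: _).
by rewrite subSn ?exprS -?mulmxE ?mulmxA// ltnW.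
Qed.

(** The control-to-state map is affine with linear part L: the contributions of [x0] and [sig] are
    common to both controls. *)
Lemma stateh_lin x0 sig u v c U :
  (forall n w, U n w = u n w + c *: v n w) ->
  forall n w, stateh M S tau W x0 sig U n w =
              stateh M S tau W x0 sig u n w + c *: L v n w.
Proof.
move=> UE; elim=> [|n IH] w; first by rewrite Lop0 scaler0 addr0.
rewrite LopS/= IH UE /xi scalemxAr -mulmxDr; congr (_ *m _).
rewrite !scalerDr !scalerDl !scale1r !scalerA !(mulrC c).
by apply/matrixP => i j; rewrite !mxE; ring.
Qed.

Lemma Lop_lin u v c U :
  (forall n w, U n w = u n w + c *: v n w) ->
  forall n w, L U n w = L u n w + c *: L v n w.
Proof.
move=> UE; elim=> [|n IH] w; first by rewrite !Lop0 scaler0 addr0.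
rewrite !LopS/= IH UE scalemxAr -mulmxDr; congr (_ *m _).
by apply/matrixP => i j; rewrite !mxE; ring.
Qed.

End linear_recursion.

(** * Abstract gradient descent *)

Lemma affine_quad_ge0_eq0 {R : realFieldType} (D q : R) : 0 <= q ->
  (forall c, 0 <= 2 * c * D + c ^+ 2 * q) -> D = 0.
Proof.
move=> q0 H; have q1 : 0 < q + 1 by rewrite ltr_wpDl.
(* Near-optimal choice of c; the shift by 1 covers q = 0. *)
have := H (- D / (q + 1)).
have -> : 2 * (- D / (q + 1)) * D + (- D / (q + 1)) ^+ 2 * q =
    - (D ^+ 2 * ((q + 2) / (q + 1) ^+ 2)) by field; rewrite gt_eqF.
have p : 0 < (q + 2) / (q + 1) ^+ 2 by rewrite divr_gt0 ?exprn_gt0// ltr_wpDl.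
rewrite oppr_ge0 pmulr_lle0// => h.
by apply/eqP; rewrite -sqrf_eq0 eq_le h sqr_ge0.
Qed.

(* a, q, G, s stand for |u|^2, <H u, u>, |H u|^2 and <H (H u), H u> along u_(l+1) = u_l - H u_l / kappa. *)
Lemma gradient_descent_rates {R : realFieldType} (kappa : R) (a q G s : nat -> R) :
  0 < kappa ->
  (forall l, 0 <= a l) -> (forall l, a l <= q l) -> (forall l, 0 <= G l) ->
  (forall l, s l <= kappa * G l) ->
  (forall l, a l.+1 = a l - 2 * kappa^-1 * q l + kappa^-1 ^+ 2 * G l) ->
  (forall l, q l.+1 = q l - 2 * kappa^-1 * G l + kappa^-1 ^+ 2 * s l) ->
  forall l, a l <= (1 - kappa^-1) ^+ l * a 0%N /\ l%:R * q l <= kappa * a 0%N.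
Proof.
move=> k0; set y := kappa^-1 => a0 aq G0 sG aE qE.
have ky : kappa * y = 1 by rewrite mulfV// gt_eqF.
have y0 : 0 < y by rewrite invr_gt0.
have ysG l : y ^+ 2 * s l <= y * G l.
  have := ler_wpM2l (ltW (exprn_gt0 2 y0)) (sG l).
  by rewrite mulrA [X in _ <= X * _](_ : _ = y)// expr2 -mulrA [y * kappa]mulrC ky mulr1.
(* Co-coercivity |H u|^2 <= kappa <H u, u> comes from 0 <= q (l + 1) <= q l - y G l. *)
have yGq l : y * G l <= q l.
  have := le_trans (a0 l.+1) (aq l.+1); rewrite qE; have := ysG l; lra.
have qdec l : q l.+1 <= q l.
  by rewrite qE; have := ysG l; have := mulr_ge0 (ltW y0) (G0 l); lra.
have adec l : a l.+1 <= a l - y * q l.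
  by rewrite aE expr2; have := ler_wpM2l (ltW y0) (yGq l); lra.
have acontr l : a l.+1 <= (1 - y) * a l.
  by have := adec l; have := ler_wpM2l (ltW y0) (aq l); lra.
move=> l; split.
  have [y1|y1] := leP 0 (1 - y).
    elim: l => [|l IH]; first by rewrite expr0 mul1r.
    by rewrite exprS -mulrA (le_trans (acontr l))// ler_wpM2l.
  (* For kappa < 1 the contraction factor is negative, which together with a (k + 1) >= 0 leaves
     only zero errors. *)
  have az k : a k = 0.
    apply/eqP; rewrite eq_le a0 andbT.
    by have := le_trans (a0 k.+1) (acontr k); rewrite nmulr_rge0.
  by rewrite !az mulr0.
have sumq : a l + y * \sum_(j < l) q j <= a 0%N.
  elim: l => [|l IH]; first by rewrite big_ord0 mulr0 addr0.
  by rewrite big_ord_recr/=; have := adec l; lra.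
have qmon j : (j <= l)%N -> q l <= q j.
  move=> jl; rewrite -(subnK jl); elim: (l - j)%N => // k IH.
  by rewrite addSn (le_trans (qdec _)).
have lq : l%:R * q l <= \sum_(j < l) q j.
  have -> : l%:R * q l = \sum_(j < l) q l by rewrite sumr_const card_ord mulr_natl.
  by apply: ler_sum => j _; apply: qmon; exact: ltnW.
have h : y * \sum_(j < l) q j <= a 0%N by have := a0 l; lra.
apply: le_trans lq _.
by have := ler_wpM2l (ltW k0) h; rewrite mulrA ky mul1r.
Qed.

Lemma cond_exp_lin {d} {Om : measurableType d} {R : realType} {m : nat}
    (P : probability Om R) (G : set (set Om)) (X X1 X2 Y Y1 Y2 : Om -> 'cV[R]_m) (a b : R) :
  <<s G>> `<=` measurable ->
  cond_exp P (<<s G>>) X1 Y1 -> cond_exp P (<<s G>>) X2 Y2 ->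
  (forall w, X w = a *: X1 w + b *: X2 w) ->
  (forall w, Y w = a *: Y1 w + b *: Y2 w) ->
  cond_exp P (<<s G>>) X Y.
Proof.
move=> Gm [GY1 C1] [GY2 C2] XE YE; split => i.
  have -> : (fun w => Y w i 0) = (fun w => a * Y1 w i 0 + b * Y2 w i 0).
    by apply/funext => w; rewrite YE !mxE.
  by apply/G_measurableE; apply: measurable_funD; apply: measurable_funM => //; apply/G_measurableE.
have [iX1 iY1 E1] := C1 i; have [iX2 iY2 E2] := C2 i.
have XiE w : (X w i 0)%:E = (a%:E * (X1 w i 0)%:E + b%:E * (X2 w i 0)%:E)%E.
  by rewrite XE !mxE EFinD !EFinM.
have YiE w : (Y w i 0)%:E = (a%:E * (Y1 w i 0)%:E + b%:E * (Y2 w i 0)%:E)%E.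
  by rewrite YE !mxE EFinD !EFinM.
split.
- by under eq_fun do rewrite XiE; apply: integrableD => //; apply: integrableZl.
- by under eq_fun do rewrite YiE; apply: integrableD => //; apply: integrableZl.
move=> A GA; have mA := Gm _ GA.
have sub f : P.-integrable setT f -> P.-integrable A f by apply: integrableS.
under eq_integral do rewrite YiE; under [RHS]eq_integral do rewrite XiE.
rewrite !integralD//; try (by apply: integrableZl => //; exact: sub).
by rewrite !integralZl//; try (by exact: sub); rewrite E1// E2.
Qed.

(** * The discretized control problem *)

Section discretization.
Context {d} {Om : measurableType d} {R : realType} {m : nat} (P : probability Om R).
Variables (M S : 'M[R]_m) (T tau : R) (N : nat) (W : R -> Om -> R).
Hypotheses (sM : SPD M) (sS : SPD S) (tau0 : 0 < tau) (NT : N%:R * tau = T).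
Hypothesis wW : is_wiener_process P T W.
Implicit Types (X Y Z : Om -> 'cV[R]_m) (u v U V : nat -> Om -> 'cV[R]_m).
Local Notation A := (A0 M S tau).
Local Notation L := (Lop M S tau W).
Local Notation F := (fun n : nat => aug_nat_filtration P W (n%:R * tau)).

(** The generators of the augmented filtration at t_n, named so that the filtration takes the form
    [<<s G>>] on which the preceding lemmas are stated. *)
Definition filtration_gen (n : nat) : set (set Om) :=
  [set B | exists s, 0 <= s <= n%:R * tau /\
           exists C : set R, measurable C /\ B = W s @^-1` C]
  `|` [set B | measurable B /\ P B = 0%E].

Let Fm n : <<s filtration_gen n>> `<=` measurable.
Proof. exact: (aug_nat_filtration_measurable P wW). Qed.

Lemma filtration_sub n k : (n <= k)%N ->
  <<s filtration_gen n>> `<=` <<s filtration_gen k>>.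
Proof.
move=> nk; apply: sub_sigma_algebra2 => B [[s [/andP[s0 sn] H]]|]; last by right.
left; exists s; split => //; rewrite s0 (le_trans sn)// ler_wpM2r ?ler_nat//.
exact: ltW.
Qed.

Lemma xi_G_measurable n : G_measurable <<s filtration_gen n.+1>> (xi tau W n.+1).
Proof.
have mW k : (k <= n.+1)%N ->
    measurable_fun setT (W (k%:R * tau) : g_sigma_algebraType (filtration_gen n.+1) -> R).
  move=> kn _ B mB; rewrite setTI; apply: sub_sigma_algebra; left.
  exists (k%:R * tau); split; last by exists B.
  by rewrite mulr_ge0 ?(ltW tau0)//= ler_wpM2r ?(ltW tau0)// ler_nat.
apply/G_measurableE; rewrite /xi /dW; apply: measurable_funD => //.
by apply: measurable_funB; apply: mW.
Qed.

Lemma xi_measurable n : measurable_fun setT (xi tau W n.+1).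
Proof. exact: G_measurable_measurable (Fm n.+1) _ (xi_G_measurable n). Qed.

Let time_bounds n : (n < N)%N ->
  [/\ 0 <= n%:R * tau, n%:R * tau < n.+1%:R * tau & n.+1%:R * tau <= T].
Proof.
move=> nN; split; first by rewrite mulr_ge0// ltW.
  by rewrite ltr_pM2r// ltr_nat.
by rewrite -NT ler_pM2r// ler_nat.
Qed.

Lemma xi_indep n B C : (n < N)%N -> <<s filtration_gen n>> B -> measurable C ->
  P (B `&` (xi tau W n.+1 @^-1` C)) = (P B * P (xi tau W n.+1 @^-1` C))%E.
Proof.
move=> nN FB mC; have [t0 t1 t2] := time_bounds n nN.
have -> : xi tau W n.+1 @^-1` C =
    increment W (n%:R * tau) (n.+1%:R * tau) @^-1` ((fun x => 1 + x) @^-1` C) by [].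
apply: (wiener_increment_indep P wW) => //.
have h : measurable_fun setT (fun x : R => 1 + x) by exact: measurable_funD.
by rewrite -[X in measurable X]setTI; exact: h.
Qed.

Lemma xi_sqr_le n : (n < N)%N ->
  (Expe P (fun w => (xi tau W n.+1 w ^+ 2)%R) <= (1 + 16 * tau)%:E)%E.
Proof.
move=> nN; have [t0 t1 t2] := time_bounds n nN.
have := increment_sqr1D_le P _ _ wW t0 t1 t2.
by rewrite -mulrBl -natrB// subSnn mul1r.
Qed.

(** * Square integrable adapted random vectors *)

Definition L2v n X := forall i, L2 P (filtration_gen n) (fun w => X w i 0).

Lemma L2v_sub n k X : (n <= k)%N -> L2v n X -> L2v k X.
Proof. by move=> nk LX i; apply: L2_sub (LX i); exact: filtration_sub. Qed.

Lemma L2v_cst n (x : 'cV[R]_m) : L2v n (cst x).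
Proof. by move=> i; exact: L2_cst. Qed.

Lemma L2v_lin n X Y c : L2v n X -> L2v n Y -> L2v n (fun w => X w + c *: Y w).
Proof.
move=> LX LY i; under eq_fun do rewrite 2!mxE.
by apply: L2D => //; apply: L2Z.
Qed.

Lemma L2vZ n X c : L2v n X -> L2v n (fun w => c *: X w).
Proof. by move=> LX i; under eq_fun do rewrite mxE; exact: L2Z. Qed.

Lemma L2v_mulmx n X (B : 'M[R]_m) : L2v n X -> L2v n (fun w => B *m X w).
Proof.
move=> LX i; under eq_fun do rewrite mxE.
by apply: L2_sum => // k; apply: L2Z.
Qed.

Lemma L2_mul_xi n (z : Om -> R) : (n < N)%N -> L2 P (filtration_gen n) z ->
  L2 P (filtration_gen n.+1) (fun w => z w * xi tau W n.+1 w).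
Proof.
move=> nN Lz; apply: (L2_mul_indep P _ _ _ _ (Fm n)) => //.
- exact: filtration_sub.
- exact: xi_G_measurable.
- exact: xi_measurable.
- by apply: le_lt_trans (xi_sqr_le n nN) _; rewrite ltry.
- by move=> B C FB mC; exact: xi_indep.
Qed.

Lemma L2v_xi n X : (n < N)%N -> L2v n X -> L2v n.+1 (fun w => xi tau W n.+1 w *: X w).
Proof.
move=> nN LX i; under eq_fun do rewrite mxE mulrC.
exact: L2_mul_xi.
Qed.

(** Factors are attached in order of time: the product up to n is measurable at t_n, hence
    independent of the next factor. *)
Lemma L2_mul_prodxi j n (z : Om -> R) : (j < n)%N -> (n <= N)%N ->
  L2 P (filtration_gen j) z -> L2 P (filtration_gen n) (fun w => z w * prodxi tau W j n w).
Proof.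
move=> + + Lz; elim: n => // n IH; rewrite ltnS leq_eqVlt => /predU1P[<-|jn] nN.
  under eq_fun do rewrite prodxiSS mulr1.
  by apply: L2_sub Lz; exact: filtration_sub.
under eq_fun do rewrite prodxiS// mulrA.
by apply: L2_mul_xi => //; apply: IH => //; exact: ltnW.
Qed.

Lemma L2v_prodxi j n X : (j < n)%N -> (n <= N)%N ->
  L2v j X -> L2v n (fun w => prodxi tau W j n w *: X w).
Proof.
move=> jn nN LX i; under eq_fun do rewrite mxE mulrC.
exact: L2_mul_prodxi.
Qed.

Lemma L2v_Lop u n : (n <= N)%N -> (forall k, (k < N)%N -> L2v k (u k)) -> L2v n (L u n).
Proof.
move=> + Lu; elim: n => [_|n IH nN].
  rewrite (_ : L u 0 = cst 0); first exact: L2v_cst.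
  by apply/funext => w; rewrite Lop0.
rewrite (_ : L u n.+1 = (fun w => A *m (xi tau W n.+1 w *: L u n w + tau *: u n w))); last first.
  by apply/funext => w; rewrite LopS.
apply/L2v_mulmx/L2v_lin; first by apply: L2v_xi => //; apply: IH; exact: ltnW.
by apply: (L2v_sub n) => //; exact: Lu.
Qed.

Lemma L2v_stateh x0 sig u n : (n <= N)%N -> (forall k, (k < N)%N -> L2v k (u k)) ->
  L2v n (stateh M S tau W x0 sig u n).
Proof.
move=> + Lu; elim: n => [_|n IH nN]; first exact: L2v_cst.
set X := stateh M S tau W x0 sig u; have LX : L2v n (X n) by apply: IH; exact: ltnW.
(* X + (X + sig) Delta W = (1 + Delta W)(X + sig) - sig, so the noise acts only through the factor
   [xi]. *)
rewrite (_ : X n.+1 = (fun w => A *m ((xi tau W n.+1 w *: (X n w + 1 *: cst (sig n) w)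
  + tau *: u n w) + (-1) *: cst (sig n) w))); last first.
  apply/funext => w; rewrite /X /=; congr (_ *m _).
  by apply/matrixP => i j; rewrite /xi !mxE; ring.
apply/L2v_mulmx/L2v_lin; last exact: L2v_cst.
apply: L2v_lin; last by apply: (L2v_sub n) => //; exact: Lu.
by apply: L2v_xi => //; apply: L2v_lin => //; exact: L2v_cst.
Qed.

(** * Bilinear pairings in expectation *)

Lemma bl_integrable (B : 'M[R]_m) n k X Y : L2v n X -> L2v k Y ->
  P.-integrable setT (fun w => (bl B (X w) (Y w))%:E).
Proof.
move=> LX LY.
under eq_fun do rewrite bl_coordE -sumEFin.
apply: integrable_sum => // i _.
have LBX : L2v n (fun w => B^T *m X w) by exact: L2v_mulmx.
exact: (L2_mul_integrable P _ _ _ _ (Fm n) (Fm k) (LBX i) (LY i)).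
Qed.

(** The control space is given by the M-norm, the calculus by coordinates; [coord_le_qf] bounds each
    coordinate by the norm. *)
Lemma in_Uht_L2v U : in_Uht P M F N U <-> forall n, (n < N)%N -> L2v n (U n).
Proof.
split => H n nN.
  have [GU EU] := H n nN; move=> i.
  have [C HC] := coord_le_qf M i sM.
  apply: (L2_dom P _ (Fm n) _ (fun w => C * qf M (U n w))) => //; first exact: GU.
  apply: (integrableZl measurableT C (f := fun w => (qf M (U n w))%:E)).
  apply/integrableP; split; last first.
    rewrite (eq_integral (fun w => (qf M (U n w))%:E))//.
    by move=> w _; rewrite /= ger0_norm// SPD_qf_ge0.
  apply/measurable_EFinP; under eq_fun do rewrite qfE bl_coordE.
  apply: measurable_sum => k; apply: measurable_funM; last exact: G_measurable_measurable (Fm n) _ (GU k).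
  under eq_fun do rewrite mxE.
  by apply: measurable_sum => l; apply: measurable_funM => //; exact: G_measurable_measurable (Fm n) _ (GU l).
have LU := H n nN; split; first by move=> i; exact: (LU i).1.
exact: integrable_lty (bl_integrable M n n _ _ LU LU).
Qed.

(** A real-valued integral, so that inner products can be manipulated by ring arithmetic; [Expe_qf]
    returns to the extended reals once integrability is known. *)
Definition Ebl (B : 'M[R]_m) X Y : R := \int[P]_w bl B (X w) (Y w).

Lemma Expe_qf B n X : L2v n X -> Expe P (fun w => qf B (X w)) = (Ebl B X X)%:E.
Proof.
by move=> LX; rewrite /Expe /Ebl fineK//; apply: integrable_fin_num => //; exact: (bl_integrable B n n X X LX LX).
Qed.

Lemma Ebl_ge0 B X : SPD B -> 0 <= Ebl B X X.
Proof. by move=> sB; apply: Rintegral_ge0 => w _; exact: SPD_qf_ge0. Qed.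

Lemma Ebl_linl B n k l X Y Z X1 c : L2v n X -> L2v k Y -> L2v l Z ->
  (forall w, X1 w = X w + c *: Y w) -> Ebl B X1 Z = Ebl B X Z + c * Ebl B Y Z.
Proof.
move=> LX LY LZ UE; have iX := bl_integrable B n l X Z LX LZ; have iY := bl_integrable B k l Y Z LY LZ.
rewrite /Ebl -RintegralZl// -RintegralD//; last exact: (integrableZl measurableT c iY).
by apply: eq_Rintegral => w _; rewrite UE blDl blZl.
Qed.

Lemma Ebl_C B X Y : B^T = B -> Ebl B X Y = Ebl B Y X.
Proof. by move=> BT; apply: eq_Rintegral => w _; rewrite blC. Qed.

Lemma Ebl_Zl B n k X Y X1 c : L2v n X -> L2v k Y ->
  (forall w, X1 w = c *: X w) -> Ebl B X1 Y = c * Ebl B X Y.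
Proof.
move=> LX LY UE; rewrite /Ebl -RintegralZl//; last exact: (bl_integrable _ _ _ _ _ LX LY).
by apply: eq_Rintegral => w _; rewrite UE blZl.
Qed.

Lemma Rintegral_sum (I : Type) (r : seq I) (Q : pred I) (f : I -> Om -> R) :
  (forall i, Q i -> P.-integrable setT (EFin \o f i)) ->
  \int[P]_w (\sum_(i <- r | Q i) f i w) = \sum_(i <- r | Q i) \int[P]_w f i w.
Proof.
move=> fi; elim: r => [|i r IH].
  rewrite big_nil; under eq_Rintegral do rewrite big_nil.
  by rewrite Rintegral_cst// mul0r.
rewrite big_cons; under eq_Rintegral do rewrite big_cons.
case: ifP => // Qi; rewrite RintegralD ?IH//; first exact: fi.
have := integrable_sum (mu := P) measurableT r (P := Q) fi.
by apply: eq_integrable => // w _; rewrite /= sumEFin.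
Qed.

Lemma Lstar_innerE U j w : Lstar_inner M S N tau W U j w =
  tau *: \sum_(n < N | (j <= n)%N) prodxi tau W j n.+1 w *: (A ^+ (n.+1 - j) *m U n.+1 w).
Proof. by rewrite /Lstar_inner big_add1 /= big_geq_mkord. Qed.

(** Testing with M v, which is measurable at t_j, replaces the conditional expectations by their
    integrands; self-adjointness of A0 then moves powers and noise factors onto v. [Y1] and [Y2] are
    only known to be integrable; square integrability is asked of the combination [Y] alone. *)
Lemma Ebl_cond_exp alpha j (Xp : nat -> Om -> 'cV[R]_m) (v Y1 Y2 Y : Om -> 'cV[R]_m) : (j < N)%N ->
  (forall n, (n <= N)%N -> L2v n (Xp n)) -> L2v j v -> L2v j Y ->
  cond_exp P (F j) (Lstar_inner M S N tau W Xp j) Y1 ->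
  cond_exp P (F j) (Lhatstar_inner M S N tau W (Xp N) j) Y2 ->
  (forall w, Y w = Y1 w + alpha *: Y2 w) ->
  Ebl M v Y =
  tau * \sum_(n < N | (j <= n)%N)
    Ebl M (fun w => prodxi tau W j n.+1 w *: (A ^+ (n.+1 - j) *m v w)) (Xp n.+1) +
  alpha * Ebl M (fun w => prodxi tau W j N w *: (A ^+ (N - j) *m v w)) (Xp N).
Proof.
move=> jN LX Lv LY [GY1 C1] [GY2 C2] YE.
set X1 := Lstar_inner _ _ _ _ _ _ _ in C1; set X2 := Lhatstar_inner _ _ _ _ _ _ _ in C2.
have [MT _] := sM.
have LMv : L2v j (fun w => M *m v w) by exact: L2v_mulmx.
pose X3 w := X1 w + alpha *: X2 w.
have LAv k : L2v j (fun w => A ^+ k *m v w) by exact: L2v_mulmx.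
have LpAv n : (j < n)%N -> (n <= N)%N ->
    L2v n (fun w => prodxi tau W j n w *: (A ^+ (n - j) *m v w)).
  move=> jn nN; exact: (L2v_prodxi j n _ jn nN (LAv _)).
(* [X3] contains products of noise factors with the correlated state. Regrouping the factors with M
   v gives a product of two square integrable variables. *)
have iX3 i : P.-integrable setT (fun w => ((M *m v w) i 0 * X3 w i 0)%:E).
  have iQ n : (j < n)%N -> (n <= N)%N -> P.-integrable setT
      (fun w => ((M *m v w) i 0 * prodxi tau W j n w * (A ^+ (n - j) *m Xp n w) i 0)%:E).
    move=> jn nN.
    have L1 := L2_mul_prodxi j n _ jn nN (LMv i).
    have L2 : L2v n (fun w => A ^+ (n - j) *m Xp n w) by apply: L2v_mulmx; exact: LX.
    exact: (L2_mul_integrable P _ _ _ _ (Fm n) (Fm n) L1 (L2 i)).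
  have i1 : P.-integrable setT (fun w => \sum_(n < N | (j <= n)%N)
     ((M *m v w) i 0 * prodxi tau W j n.+1 w * (A ^+ (n.+1 - j) *m Xp n.+1 w) i 0)%:E).
    by apply: integrable_sum => // n jn; apply: iQ.
  have := integrableD measurableT (integrableZl measurableT tau i1)
    (integrableZl measurableT alpha (iQ N jN (leqnn N))).
  apply: eq_integrable => // w _ /=.
  rewrite sumEFin -!EFinM -EFinD; congr EFin; rewrite /X3 /X1 /X2 Lstar_innerE.
  rewrite /Lhatstar_inner -/(prodxi tau W j N w) !mxE summxE mulrDr; congr (_ + _).
    rewrite mulrCA; congr (_ * _); rewrite mulr_sumr; apply: eq_bigr => n _.
    by rewrite [X in _ = _ * X]mxE mulrA.
  ring.
have iY i : P.-integrable setT (fun w => ((M *m v w) i 0 * Y w i 0)%:E).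
  exact: (L2_mul_integrable P _ _ _ _ (Fm j) (Fm j) (LMv i) (LY i)).
(* Tower property, coordinate by coordinate: X3 - Y integrates to zero over every event known at
   t_j. *)
have MvY i : (\int[P]_w ((M *m v w) i 0 * (X3 w i 0 - Y w i 0))%:E = 0)%E.
  have [iX1 iY1 E1] := C1 i; have [iX2 iY2 E2] := C2 i.
  have iD1 : P.-integrable setT (fun w => (X1 w i 0 - Y1 w i 0)%:E).
    exact: (integrableB measurableT iX1 iY1).
  have iD2 : P.-integrable setT (fun w => (alpha * (X2 w i 0 - Y2 w i 0))%:E).
    exact: (integrableZl measurableT alpha (integrableB measurableT iX2 iY2)).
  have DE w : X3 w i 0 - Y w i 0 = (X1 w i 0 - Y1 w i 0) + alpha * (X2 w i 0 - Y2 w i 0).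
    by rewrite YE /X3 !mxE; ring.
  apply: (G_measurable_mul_integral_eq0 P (filtration_gen j) (Fm j) (fun w => (M *m v w) i 0)
    (fun w => X3 w i 0 - Y w i 0)).
  - exact: (LMv i).1.
  - have := integrableD measurableT iD1 iD2.
    by apply: eq_integrable => // w _; rewrite /= DE.
  - have := integrableB measurableT (iX3 i) (iY i).
    by apply: eq_integrable => // w _; rewrite /= -EFinB -mulrBr.
  move=> B FB; have mB := Fm j _ FB.
  have sub f : P.-integrable setT f -> P.-integrable B f.
    by apply: integrableS.
  under eq_integral do rewrite DE EFinD.
  rewrite integralD//; try exact: sub.
  under [X in (_ + X)%E]eq_integral do rewrite EFinM.
  rewrite integralZl//; last by apply: sub; exact: (integrableB measurableT iX2 iY2).
  under eq_integral do rewrite EFinB.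
  under [X in (_ + _ * X)%E]eq_integral do rewrite EFinB.
  rewrite !integralB//; try exact: sub.
  rewrite (E1 _ FB) (E2 _ FB) !subee ?mule0 ?adde0//.
    by apply: integrable_fin_num => //; exact: sub iX2.
  by apply: integrable_fin_num => //; exact: sub iX1.
have blX3 w : bl M (v w) (X3 w) =
    tau * (\sum_(n < N | (j <= n)%N)
      bl M (prodxi tau W j n.+1 w *: (A ^+ (n.+1 - j) *m v w)) (Xp n.+1 w)) +
    alpha * bl M (prodxi tau W j N w *: (A ^+ (N - j) *m v w)) (Xp N w).
  rewrite blDr blZr /X1 Lstar_innerE blZr bl_sumr; congr (_ * _ + _ * _).
    by apply: eq_bigr => n _; rewrite blZr blZl A0_adjoint.
  by rewrite /X2 /Lhatstar_inner -/(prodxi tau W j N w) blZr blZl A0_adjoint.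
have iS : P.-integrable setT (EFin \o (fun w => \sum_(n < N | (j <= n)%N)
      bl M (prodxi tau W j n.+1 w *: (A ^+ (n.+1 - j) *m v w)) (Xp n.+1 w))).
  have := @integrable_sum _ _ R P setT measurableT 'I_N (index_enum 'I_N)
    (fun n => (j <= n)%N) (fun n w => (bl M (prodxi tau W j n.+1 w *:
       (A ^+ (n.+1 - j) *m v w)) (Xp n.+1 w))%:E).
  move=> H; have {}H := H _; apply: eq_integrable (H _) => //.
    by move=> w _; rewrite /= sumEFin.
  move=> n jn; apply: bl_integrable; [exact: LpAv|exact: LX].
have iT : P.-integrable setT (EFin \o (fun w =>
    bl M (prodxi tau W j N w *: (A ^+ (N - j) *m v w)) (Xp N w))).
  by apply: bl_integrable; [exact: LpAv|exact: LX].
transitivity (\int[P]_w bl M (v w) (X3 w)); last first.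
  under eq_Rintegral do rewrite blX3.
  rewrite RintegralD//; last 2 first.
  - exact: (integrableZl measurableT tau iS).
  - exact: (integrableZl measurableT alpha iT).
  rewrite !RintegralZl// Rintegral_sum// => n jn.
  by apply: bl_integrable; [exact: LpAv|exact: LX].
have iX3b : P.-integrable setT (EFin \o (fun w => bl M (v w) (X3 w))).
  have := @integrable_sum _ _ R P setT measurableT 'I_m (index_enum 'I_m) predT
    (fun i w => ((M *m v w) i 0 * X3 w i 0)%:E) (fun i _ => iX3 i).
  by apply: eq_integrable => // w _; rewrite /= bl_coordE MT sumEFin.
apply/eqP; rewrite -subr_eq0 /Ebl -RintegralB//; last exact: (bl_integrable _ _ _ _ _ Lv LY).
apply/eqP; transitivity (\int[P]_w (\sum_i - ((M *m v w) i 0 * (X3 w i 0 - Y w i 0)))).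
  apply: eq_Rintegral => w _; rewrite !bl_coordE MT -sumrB.
  by apply: eq_bigr => i _; ring.
have iZ i : P.-integrable setT (EFin \o (fun w => - ((M *m v w) i 0 * (X3 w i 0 - Y w i 0)))).
  have := integrableB measurableT (iY i) (iX3 i).
  by apply: eq_integrable => // w _; rewrite /= -EFinB; congr EFin; ring.
rewrite Rintegral_sum// big1// => i _.
rewrite /Rintegral; under eq_integral do rewrite -mulN1r EFinM.
rewrite integralZl ?MvY ?mule0//.
have := integrableZl measurableT (-1) (iZ i).
by apply: eq_integrable => // w _; rewrite /= -EFinM; congr EFin; ring.
Qed.

(** * The cost as a quadratic form on state-control pairs *)

Definition adapted_L2 (X : nat -> Om -> 'cV[R]_m) := forall n, (n <= N)%N -> L2v n (X n).
Definition admissible (u : nat -> Om -> 'cV[R]_m) := forall n, (n < N)%N -> L2v n (u n).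

Definition ip u v : R := tau * \sum_(n < N) Ebl M (u n) (v n).

(* The polar form of 2 J_tau on pairs (state, control); with X = L u and Y = L v it
   is the Hessian of the reduced functional. *)
Definition costform (alpha : R) (X u Y v : nat -> Om -> 'cV[R]_m) : R :=
  ip u v + tau * (\sum_(n < N) Ebl M (X n.+1) (Y n.+1)) + alpha * Ebl M (X N) (Y N).

Lemma Lop_adapted u : admissible u -> adapted_L2 (L u).
Proof. by move=> au n nN; exact: L2v_Lop. Qed.

Lemma stateh_adapted x0 sig u : admissible u -> adapted_L2 (stateh M S tau W x0 sig u).
Proof. by move=> au n nN; exact: L2v_stateh. Qed.

Lemma ip_lin u a b v c : admissible a -> admissible b -> admissible v ->
  (forall n w, u n w = a n w + c *: b n w) -> ip u v = ip a v + c * ip b v.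
Proof.
move=> aa ab av uE; rewrite /ip mulrCA -mulrDr; congr (_ * _).
rewrite mulr_sumr -big_split/=; apply: eq_bigr => n _.
exact: (Ebl_linl M n n n _ _ _ _ c (aa n (ltn_ord n)) (ab n (ltn_ord n)) (av n (ltn_ord n))).
Qed.

Lemma ipC u v : ip u v = ip v u.
Proof. by rewrite /ip; congr (_ * _); apply: eq_bigr => n _; rewrite Ebl_C; case: sM. Qed.

Lemma ip_ge0 u : 0 <= ip u u.
Proof. by rewrite mulr_ge0 ?(ltW tau0)// sumr_ge0// => n _; exact: Ebl_ge0. Qed.

Lemma normU2_ip u : admissible u -> normU2 P M N tau u = (ip u u)%:E.
Proof.
move=> au; rewrite /normU2 /ip EFinM -sumEFin; congr (_ * _)%E.
by apply: eq_bigr => n _; apply: Expe_qf; exact: au.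
Qed.

Lemma costform_lin alpha (X u X1 u1 X2 u2 Y v : nat -> Om -> 'cV[R]_m) c :
  adapted_L2 X1 -> admissible u1 -> adapted_L2 X2 -> admissible u2 ->
  adapted_L2 Y -> admissible v ->
  (forall n w, X n w = X1 n w + c *: X2 n w) ->
  (forall n w, u n w = u1 n w + c *: u2 n w) ->
  costform alpha X u Y v = costform alpha X1 u1 Y v + c * costform alpha X2 u2 Y v.
Proof.
move=> aX1 au1 aX2 au2 aY av XE uE; rewrite /costform (ip_lin u u1 u2 v c)//.
have EX n : (n <= N)%N -> Ebl M (X n) (Y n) = Ebl M (X1 n) (Y n) + c * Ebl M (X2 n) (Y n).
  by move=> nN; exact: (Ebl_linl M n n n _ _ _ _ c (aX1 n nN) (aX2 n nN) (aY n nN)).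
rewrite EX//; under eq_bigr => n _ do rewrite EX//.
by rewrite big_split/= -mulr_sumr; ring.
Qed.

Lemma costformC alpha (X u Y v : nat -> Om -> 'cV[R]_m) : costform alpha X u Y v = costform alpha Y v X u.
Proof.
have [MT _] := sM; rewrite /costform ipC; congr (_ + tau * _ + alpha * _).
  by apply: eq_bigr => n _; rewrite Ebl_C.
by rewrite Ebl_C.
Qed.

Lemma costform_ge alpha (X u : nat -> Om -> 'cV[R]_m) : 0 <= alpha -> ip u u <= costform alpha X u X u.
Proof.
move=> a0; rewrite /costform -addrA lerDl addr_ge0// mulr_ge0 ?(ltW tau0) ?Ebl_ge0//.
by apply: sumr_ge0 => n _; exact: Ebl_ge0.
Qed.

Lemma costform_sqr alpha (X u X1 u1 X2 u2 : nat -> Om -> 'cV[R]_m) c :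
  adapted_L2 X1 -> admissible u1 -> adapted_L2 X2 -> admissible u2 ->
  adapted_L2 X -> admissible u ->
  (forall n w, X n w = X1 n w + c *: X2 n w) ->
  (forall n w, u n w = u1 n w + c *: u2 n w) ->
  costform alpha X u X u = costform alpha X1 u1 X1 u1 +
    2 * c * costform alpha X1 u1 X2 u2 + c ^+ 2 * costform alpha X2 u2 X2 u2.
Proof.
move=> aX1 au1 aX2 au2 aX au XE uE.
rewrite (costform_lin alpha X u X1 u1 X2 u2 X u c)//.
rewrite (costformC alpha X1) (costform_lin alpha X u X1 u1 X2 u2 X1 u1 c)//.
rewrite (costformC alpha X2 _ X) (costform_lin alpha X u X1 u1 X2 u2 X2 u2 c)//.
by rewrite (costformC alpha X2 u2 X1 u1); ring.
Qed.

Lemma Jhat_costform alpha x0 sig u : admissible u ->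
  let X := stateh M S tau W x0 sig u in
  Jhat P M S N tau alpha W x0 sig u = (2^-1 * costform alpha X u X u)%:E.
Proof.
move=> au X; have aX : adapted_L2 X by exact: stateh_adapted.
rewrite /Jhat /Jtau -/X normU2_ip// /normX2 (Expe_qf M N)//; last exact: aX.
rewrite (eq_bigr (fun n : 'I_N => (Ebl M (X n.+1) (X n.+1))%:E)); last first.
  by move=> n _; apply: (Expe_qf M n.+1); exact: aX.
rewrite sumEFin -!EFinM -EFinD; congr EFin.
by rewrite /costform; field.
Qed.

(** Discrete duality: exchanging the double sum over j <= n turns the backward sums defining the
    adjoint variables into the forward sums defining L v. *)
Lemma pairing_cond_exp alpha (X u v g : nat -> Om -> 'cV[R]_m) :
  adapted_L2 X -> admissible u -> admissible v -> admissible g ->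
  (forall j, (j < N)%N -> exists Y1 Y2 : Om -> 'cV[R]_m,
     [/\ cond_exp P (F j) (Lstar_inner M S N tau W X j) Y1,
         cond_exp P (F j) (Lhatstar_inner M S N tau W (X N) j) Y2
       & forall w, g j w = u j w + (Y1 w + alpha *: Y2 w)]) ->
  ip g v = costform alpha X u (L v) v.
Proof.
move=> aX au av ag H; have [MT _] := sM.
pose a j n := Ebl M (fun w => prodxi tau W j n w *: (A ^+ (n - j) *m v j w)) (X n).
have ca j n : (j < n)%N -> (n <= N)%N ->
    L2v n (fun w => prodxi tau W j n w *: (A ^+ (n - j) *m v j w)).
  move=> jn nN; apply: L2v_prodxi => //; apply: L2v_mulmx; apply: av.
  exact: leq_trans nN.
have gE (j : 'I_N) : Ebl M (g j) (v j) = Ebl M (u j) (v j) +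
    (tau * (\sum_(n < N | (j <= n)%N) a j n.+1) + alpha * a j N).
  have jN := ltn_ord j; have [Y1 [Y2 [C1 C2 E]]] := H j jN.
  rewrite -(Ebl_cond_exp alpha j X (v j) Y1 Y2 (fun w => g j w + (-1) *: u j w))//; last 3 first.
  - exact: av.
  - by apply: L2v_lin; [exact: ag|exact: au].
  - by move=> w; rewrite E scaleN1r addrAC subrr add0r.
  rewrite (Ebl_C _ (v j))// (Ebl_linl M j j j (g j) (u j) (v j) (fun w => g j w + (-1) *: u j w) (-1) (ag j jN) (au j jN) (av j jN))//.
  by ring.
have LE n : (n <= N)%N -> Ebl M (X n) (L v n) = tau * \sum_(j < n) a j n.
  move=> nN; rewrite Ebl_C//.
  have iS (j : 'I_n) : P.-integrable setT (EFin \o (fun w =>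
      bl M (prodxi tau W j n w *: (A ^+ (n - j) *m v j w)) (X n w))).
    by apply: bl_integrable; [apply: ca => //; exact: ltn_ord|exact: aX].
  rewrite /Ebl; under eq_Rintegral => w _.
    rewrite /Lop blZl bl_suml; under eq_bigr => j _ do rewrite -/(prodxi tau W j n w).
    over.
  rewrite RintegralZl//; first by rewrite Rintegral_sum.
  have := @integrable_sum _ _ R P setT measurableT 'I_n (index_enum 'I_n) predT
    (fun j w => (bl M (prodxi tau W j n w *: (A ^+ (n - j) *m v j w)) (X n w))%:E)
    (fun j _ => iS j).
  by apply: eq_integrable => // w _; rewrite /= sumEFin.
rewrite /costform /ip; under eq_bigr do rewrite gE.
under [X in _ = _ + tau * X + _]eq_bigr do rewrite LE//.
rewrite LE// big_split/= mulrDr -addrA; congr (_ + _).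
rewrite big_split/= -!mulr_sumr mulrDr; congr (_ + _); last by ring.
congr (_ * (_ * _)).
rewrite (exchange_big_dep xpredT)//=; apply: eq_bigr => n _.
by rewrite (big_ord_widen N (fun j => a j n.+1))//; apply: eq_bigl => j; rewrite ltnS.
Qed.

(** * Discrete energy estimate and Gronwall inequality *)

Lemma Ebl_xi_le n X : (n < N)%N -> L2v n X ->
  Ebl M (fun w => xi tau W n.+1 w *: X w) (fun w => xi tau W n.+1 w *: X w) <=
  (1 + 16 * tau) * Ebl M X X.
Proof.
move=> nN LX; have LxX := L2v_xi n X nN LX.
have GX : G_measurable <<s filtration_gen n>> (fun w => qf M (X w)).
  apply/G_measurableE; under eq_fun do rewrite qfE bl_coordE.
  apply: measurable_sum => k; apply: measurable_funM; apply/G_measurableE.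
    exact: (L2v_mulmx n X M^T LX k).1.
  exact: (LX k).1.
rewrite -lee_fin -(Expe_qf M n.+1)// EFinM -(Expe_qf M n)//.
have -> : Expe P (fun w => qf M (xi tau W n.+1 w *: X w)) =
    Expe P (fun w => qf M (X w) * xi tau W n.+1 w ^+ 2).
  by apply: eq_integral => w _; rewrite !qfE blZl blZr; congr EFin; ring.
rewrite (Expe_mul_indep P (fun w => qf M (X w)) (xi tau W n.+1) (fun x => x ^+ 2)).
- rewrite muleC; apply: lee_pmul; last exact: lexx.
  + by apply: integral_ge0 => w _; rewrite lee_fin sqr_ge0.
  + by apply: integral_ge0 => w _; rewrite lee_fin SPD_qf_ge0.
  + exact: xi_sqr_le.
- exact: G_measurable_measurable (Fm n) _ GX.
- exact: xi_measurable.
- exact: measurable_funX.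
- by move=> w; exact: SPD_qf_ge0.
- by move=> x; exact: sqr_ge0.
- by move=> B C mB mC; apply: xi_indep => //; exact: GX.
Qed.

Lemma energy_step n u : (n < N)%N -> tau <= 1 -> admissible u ->
  Ebl M (L u n.+1) (L u n.+1) + 2 * tau * Ebl S (L u n.+1) (L u n.+1) <=
  (1 + 33 * tau) * Ebl M (L u n) (L u n) + 2 * tau * Ebl M (u n) (u n).
Proof.
move=> nN tau1 au; have aL := Lop_adapted u au.
have LL := aL n (ltnW nN); have LL1 := aL n.+1 nN; have Lu := au n nN.
have LxL := L2v_xi n _ nN LL.
set e := L u n; set e1 := L u n.+1.
pose xe := fun w => xi tau W n.+1 w *: e w.
have i1 := bl_integrable M _ _ _ _ LL1 LL1.
have i2 := bl_integrable S _ _ _ _ LL1 LL1.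
have i3 := bl_integrable M _ _ _ _ LxL LxL.
have i4 := bl_integrable M _ _ _ _ Lu Lu.
(* Young's inequality splits the cross term 2 tau (xe, u) into tau |xe|^2 + tau |u|^2. *)
have H : Ebl M e1 e1 + 2 * tau * Ebl S e1 e1 <=
    (1 + tau) * Ebl M xe xe + (tau + tau ^+ 2) * Ebl M (u n) (u n).
  rewrite /Ebl -!RintegralZl// -!RintegralD//; try exact: (integrableZl measurableT _ i3);
    try exact: (integrableZl measurableT _ i4); try exact: (integrableZl measurableT _ i2).
  apply: le_Rintegral => //.
  - exact: (integrableD measurableT i1 (integrableZl measurableT (2 * tau) i2)).
  - exact: (integrableD measurableT (integrableZl measurableT (1 + tau) i3)
      (integrableZl measurableT (tau + tau ^+ 2) i4)).
  move=> w _; rewrite /e1 LopS -!qfE.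
  apply: le_trans (A0_energy _ _ _ sM sS tau0 _) _.
  have [MT _] := sM; rewrite -/e -[_ *: e w]/(xe w).
  have := SPD_qf_ge0 M (xe w + (-1) *: u n w) sM.
  rewrite !qfE !blDl !blDr !blZl !blZr (blC M (u n w))// => h.
  by have := mulr_ge0 (ltW tau0) h; lra.
have := Ebl_xi_le n e nN LL; rewrite -/xe => h.
have e0 := Ebl_ge0 M e sM; have u0 := Ebl_ge0 M (u n) sM.
(* tau <= 1 enters here: (1 + tau)(1 + 16 tau) <= 1 + 33 tau and tau + tau^2 <= 2 tau. *)
have tt : tau * tau <= tau by rewrite ler_piMr// ltW.
apply: le_trans H _; apply: lerD.
  apply: (@le_trans _ _ ((1 + tau) * ((1 + 16 * tau) * Ebl M e e))).
    by rewrite ler_wpM2l// addr_ge0// ltW.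
  by rewrite mulrA ler_wpM2r//; lra.
by rewrite ler_wpM2r//; lra.
Qed.

Lemma energy_bound n u : (n <= N)%N -> tau <= 1 -> admissible u ->
  Ebl M (L u n) (L u n) + \sum_(j < n) 2 * tau * Ebl S (L u j.+1) (L u j.+1) <=
  2 * expR (33 * T) * ip u u.
Proof.
move=> nN tau1 au.
have t33 : 0 <= 33 * tau by rewrite mulr_ge0// ltW.
have c1 : 1 <= 1 + 33 * tau by rewrite lerDl.
have u0 k : 0 <= 2 * tau * Ebl M (u k) (u k).
  by rewrite !mulr_ge0 ?(ltW tau0)//; exact: Ebl_ge0.
(* The gradient sum is carried through the induction: the growth factor is at least 1, so
   multiplying the accumulated terms by it only enlarges them. *)
have H : Ebl M (L u n) (L u n) + \sum_(j < n) 2 * tau * Ebl S (L u j.+1) (L u j.+1) <=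
    (1 + 33 * tau) ^+ n * \sum_(j < n) 2 * tau * Ebl M (u j) (u j).
  elim: n nN => [_|n IH nN].
    rewrite !big_ord0 mulr0 addr0 /Ebl.
    by under eq_Rintegral do rewrite Lop0 /bl mulmx0 mxE; rewrite Rintegral_cst// mul0r.
  have {}IH := IH (ltnW nN); rewrite !big_ord_recr/=.
  set s := \sum_(j < n) _ in IH *; set G := \sum_(j < n) _ in IH *.
  have h := energy_step n u nN tau1 au.
  have s0 : 0 <= s.
    by apply: sumr_ge0 => j _; rewrite !mulr_ge0 ?(ltW tau0)//; exact: Ebl_ge0.
  have cn : 1 <= (1 + 33 * tau) ^+ n.+1 by exact: exprn_ege1.
  have := ler_wpM2l (le_trans ler01 c1) IH; rewrite mulrA -exprS => {}IH.
  have un := u0 n.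
  have h2 : 2 * tau * Ebl M (u n) (u n) <= (1 + 33 * tau) ^+ n.+1 * (2 * tau * Ebl M (u n) (u n)).
    by rewrite ler_peMl.
  have h3 : s <= (1 + 33 * tau) * s by rewrite ler_peMl.
  rewrite mulrDr; rewrite mulrDr in IH; lra.
have cE : (1 + 33 * tau) ^+ n <= expR (33 * T).
  apply: (@le_trans _ _ (expR (33 * tau) ^+ n)).
    rewrite lerXn2r ?nnegrE ?expR_ge0 ?(le_trans ler01)//; exact: expR_ge1Dx.
  rewrite -expRM_natl ler_expR -NT mulrCA ler_wpM2l//.
  by rewrite ler_wpM2r ?(ltW tau0)// ler_nat.
have GE : \sum_(j < n) 2 * tau * Ebl M (u j) (u j) <= 2 * ip u u.
  rewrite /ip mulrA mulr_sumr.
  rewrite (big_ord_widen N (fun j => 2 * tau * Ebl M (u j) (u j)))//.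
  by rewrite big_mkcond/=; apply: ler_sum => j _; case: ifP.
apply: le_trans H _; rewrite [2 * expR _]mulrC -[leRHS]mulrA.
apply: ler_pM => //; last exact: sumr_ge0.
by rewrite exprn_ge0// (le_trans ler01).
Qed.

Lemma ip_sqr (u a b : nat -> Om -> 'cV[R]_m) c : admissible u -> admissible a -> admissible b ->
  (forall n w, u n w = a n w + c *: b n w) ->
  ip u u = ip a a + 2 * c * ip a b + c ^+ 2 * ip b b.
Proof.
move=> au aa ab uE; rewrite (ip_lin u a b u c)// (ipC a u) (ipC b u).
by rewrite (ip_lin u a b a c)// (ip_lin u a b b c)// (ipC b a); ring.
Qed.

Lemma admissible_lin (a b : nat -> Om -> 'cV[R]_m) c : admissible a -> admissible b ->
  admissible (fun n w => a n w + c *: b n w).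
Proof. by move=> aa ab n nN; apply: L2v_lin; [exact: aa|exact: ab]. Qed.

(** Along Us + c v the cost is exactly quadratic in c and minimal at c = 0, so its linear
    coefficient vanishes. *)
Lemma optimality_condition alpha x0 sig (Us v : nat -> Om -> 'cV[R]_m) : 0 <= alpha ->
  admissible Us -> admissible v ->
  (forall V, admissible V -> (Jhat P M S N tau alpha W x0 sig Us <=
                              Jhat P M S N tau alpha W x0 sig V)%E) ->
  costform alpha (stateh M S tau W x0 sig Us) Us (L v) v = 0.
Proof.
move=> a0 aUs av opt; set X := stateh _ _ _ _ _ _ _.
have aX : adapted_L2 X by exact: stateh_adapted.
have aLv := Lop_adapted v av.
apply: (affine_quad_ge0_eq0 _ (costform alpha (L v) v (L v) v)).
  by apply: le_trans (ip_ge0 v) (costform_ge _ _ _ a0).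
move=> c; pose V := fun n w => Us n w + c *: v n w.
have aV : admissible V by exact: admissible_lin.
have := opt V aV; rewrite !Jhat_costform// lee_fin ler_pM2l// -/X.
have aXV := stateh_adapted x0 sig V aV.
rewrite (costform_sqr alpha _ V X Us (L v) v c)//; last first.
  by move=> n w; apply: stateh_lin.
lra.
Qed.

Lemma Lstar_inner_lin (X Y Z : nat -> Om -> 'cV[R]_m) a b j w :
  (forall n w, X n w = a *: Y n w + b *: Z n w) ->
  Lstar_inner M S N tau W X j w =
  a *: Lstar_inner M S N tau W Y j w + b *: Lstar_inner M S N tau W Z j w.
Proof.
move=> XE; rewrite !Lstar_innerE !scalerA ![_ * tau]mulrC -!scalerA -scalerDr; congr (_ *: _).
rewrite !scaler_sumr -big_split/=; apply: eq_bigr => n _.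
rewrite XE mulmxDr -!scalemxAr scalerDr !scalerA.
by rewrite ![_ * prodxi _ _ _ _ _]mulrC.
Qed.

Lemma Lhatstar_inner_lin (x y z : Om -> 'cV[R]_m) a b j w :
  x w = a *: y w + b *: z w ->
  Lhatstar_inner M S N tau W x j w =
  a *: Lhatstar_inner M S N tau W y j w + b *: Lhatstar_inner M S N tau W z j w.
Proof.
move=> xE; rewrite /Lhatstar_inner -/(prodxi tau W j N w) xE mulmxDr -!scalemxAr.
by rewrite scalerDr !scalerA ![_ * prodxi _ _ _ _ _]mulrC.
Qed.

(** * Error recursion and rates for the iterates *)

Section gradient_descent.
Variables (alpha kappa : R) (x0 : 'cV[R]_m) (sig : nat -> 'cV[R]_m).
Variables (U : nat -> nat -> Om -> 'cV[R]_m) (Us : nat -> Om -> 'cV[R]_m).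
Hypotheses (alpha0 : 0 <= alpha) (kappa0 : 0 < kappa).
Hypothesis hess : hessian_norm_le P M S F N tau alpha W kappa.
Hypothesis aU : forall l, admissible (U l).
Hypothesis gd : forall l, gd_step P M S F N tau alpha kappa W x0 sig (U l) (U l.+1).
Hypothesis aUs : admissible Us.
Hypothesis opt : forall V, admissible V ->
  (Jhat P M S N tau alpha W x0 sig Us <= Jhat P M S N tau alpha W x0 sig V)%E.

Let X l := stateh M S tau W x0 sig (U l).
Let Xs := stateh M S tau W x0 sig Us.
Definition control_error l n w := U l n w - Us n w.
Local Notation u := control_error.
(* The gradient at U^(l), which is square integrable because the iterates are. *)
Let g l n w := kappa *: (U l n w - U l.+1 n w).
Definition hess_sqr l := costform alpha (L (u l)) (u l) (L (u l)) (u l).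

Lemma control_error_admissible l : admissible (u l).
Proof.
rewrite (_ : u l = fun n w => U l n w + (-1) *: Us n w); first exact: admissible_lin.
by apply/funext => n; apply/funext => w; rewrite scaleN1r.
Qed.
Let au := control_error_admissible.

Let ag l : admissible (g l).
Proof.
move=> n nN; rewrite /g.
rewrite (_ : (fun w => _) = (fun w => kappa *: (U l n w + (-1) *: U l.+1 n w))).
  by apply: L2vZ; apply: L2v_lin; exact: aU.
by apply/funext => w; rewrite scaleN1r.
Qed.

(** True at every index n, also beyond the horizon, because [g] is a difference of iterates; the
    linearity lemmas ask for such unrestricted identities. *)
Let uE l n w : u l.+1 n w = u l n w + (- kappa^-1) *: g l n w.
Proof.
rewrite /control_error /g scalerA mulNr mulVf ?gt_eqF// scaleN1r opprB addrC.
by rewrite addrACA addrAC addrA; apply/matrixP => i j; rewrite !mxE; ring.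
Qed.

Lemma stateh_control_error l n w : X l n w = Xs n w + 1 *: L (u l) n w.
Proof.
apply: stateh_lin => k v; rewrite scale1r /control_error.
by apply/matrixP => i j; rewrite !mxE; ring.
Qed.

(** The Hessian bound quantifies over whole processes of conditional expectations, whereas a step of
    the algorithm gives them one index at a time. *)
Let gd_cond_exp l : exists Y : nat -> (Om -> 'cV[R]_m) * (Om -> 'cV[R]_m),
  forall j, (j < N)%N ->
   [/\ cond_exp P (F j) (Lstar_inner M S N tau W (X l) j) (Y j).1,
       cond_exp P (F j) (Lhatstar_inner M S N tau W (X l N) j) (Y j).2
     & forall w, g l j w = U l j w + ((Y j).1 w + alpha *: (Y j).2 w)].
Proof.
suff H j : exists Y : (Om -> 'cV[R]_m) * (Om -> 'cV[R]_m), (j < N)%N ->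
   [/\ cond_exp P (F j) (Lstar_inner M S N tau W (X l) j) Y.1,
       cond_exp P (F j) (Lhatstar_inner M S N tau W (X l N) j) Y.2
     & forall w, g l j w = U l j w + (Y.1 w + alpha *: Y.2 w)].
  by have [Y HY] := choice H; exists Y.
(* From N on the zero pair is arbitrary filler for [choice]. *)
have [jN|jN] := ltnP j N; last by exists (cst 0, cst 0).
have [Y1 [Y2 [C1 C2 E]]] := gd l j jN; exists (Y1, Y2) => _; split => // w.
rewrite /g E /=; apply/matrixP => i k; rewrite !mxE; field.
by rewrite gt_eqF.
Qed.

(** Weak form of g_l = H u_l: the state-control pair splits into the optimal pair plus (L u_l, u_l),
    and the optimal part pairs to zero. *)
Let ip_g l v : admissible v -> ip (g l) v = costform alpha (L (u l)) (u l) (L v) v.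
Proof.
move=> av; have [Y HY] := gd_cond_exp l.
have aX := stateh_adapted x0 sig (U l) (aU l).
have aXs := stateh_adapted x0 sig Us aUs.
rewrite (pairing_cond_exp alpha (X l) (U l) v)//; last first.
- by move=> j jN; exists (Y j).1, (Y j).2; exact: HY.
rewrite (costform_lin alpha (X l) (U l) Xs Us (L (u l)) (u l) (L v) v 1)//; last 4 first.
- exact: Lop_adapted.
- exact: Lop_adapted.
- exact: stateh_control_error.
- move=> n w; rewrite scale1r /control_error.
  by apply/matrixP => i j; rewrite !mxE; ring.
by rewrite optimality_condition// mul1r add0r.
Qed.

(* By linearity of the gradient, the Hessian maps g_l to kappa (g_l - g_(l+1)); the bound kappa
   on its norm thus says |g_l - g_(l+1)| <= |g_l|. The conditional expectations needed to apply
   the hypothesis on g_l are differences of those of two consecutive steps. *)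
Let ip_gg l : 0 <= ip (g l) (g l.+1).
Proof.
have [Y HY] := gd_cond_exp l; have [Y' HY'] := gd_cond_exp l.+1.
have k0 : kappa != 0 by rewrite gt_eqF.
have LgE n w : L (g l) n w = kappa *: X l n w + (- kappa) *: X l.+1 n w.
  have -> : X l n w = X l.+1 n w + kappa^-1 *: L (g l) n w.
    apply: stateh_lin => k v; rewrite /g scalerA mulVf// scale1r.
    by apply/matrixP => i j; rewrite !mxE; ring.
  by apply/matrixP => i j; rewrite !mxE; field.
have gU : in_Uht P M F N (g l) by apply/(in_Uht_L2v (g l)); exact: ag.
have := hess (g l) gU (fun j w => kappa *: (Y j).1 w + (- kappa) *: (Y' j).1 w)
  (fun j w => kappa *: (Y j).2 w + (- kappa) *: (Y' j).2 w).
have H j : (j < N)%N ->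
   cond_exp P (F j) (Lstar_inner M S N tau W (L (g l)) j)
     (fun w => kappa *: (Y j).1 w + (- kappa) *: (Y' j).1 w) /\
   cond_exp P (F j) (Lhatstar_inner M S N tau W (L (g l) N) j)
     (fun w => kappa *: (Y j).2 w + (- kappa) *: (Y' j).2 w).
  move=> jN; have [C1 C2 _] := HY j jN; have [C1' C2' _] := HY' j jN; split.
    apply: (cond_exp_lin P (filtration_gen j) _ _ _ _ _ _ _ _ (Fm j) C1 C1') => // w.
    exact: Lstar_inner_lin.
  apply: (cond_exp_lin P (filtration_gen j) _ _ _ _ _ _ _ _ (Fm j) C2 C2') => // w.
  by apply: Lhatstar_inner_lin; exact: LgE.
move=> /(_ H); rewrite (normU2_ip (g l))//.
pose h n w := kappa *: g l n w + (- kappa) *: g l.+1 n w.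
have ah : admissible h.
  move=> n nN; apply: L2v_lin; last exact: ag.
  by apply: L2vZ; exact: ag.
(* In kappa g_l - kappa g_(l+1) both gradients are expanded by adjoint variables; the control parts
   recombine to g_l by its definition. *)
have -> : normU2 P M N tau (fun j w => (g l j w +
    (kappa *: (Y j).1 w + (- kappa) *: (Y' j).1 w) +
    alpha *: (kappa *: (Y j).2 w + (- kappa) *: (Y' j).2 w))%R) = normU2 P M N tau h.
  congr (_ * _)%E; apply: eq_bigr => j _; apply: eq_integral => w _.
  have [_ _ E] := HY j (ltn_ord j); have [_ _ E'] := HY' j (ltn_ord j).
  congr ((qf M _)%:E); rewrite /h E' {2}E /g.
  by apply/matrixP => i k; rewrite !mxE; ring.
rewrite normU2_ip// -EFinM lee_fin.
rewrite (ip_sqr h (fun n w => kappa *: g l n w) (g l.+1) (- kappa))//; last first.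
  by move=> n nN; apply: L2vZ; exact: ag.
have kg v : admissible v -> ip (fun n w => kappa *: g l n w) v = kappa * ip (g l) v.
  move=> av; rewrite /ip mulrCA; congr (_ * _); rewrite mulr_sumr; apply: eq_bigr => n _.
  exact: (Ebl_Zl M n n _ _ _ _ (ag l n (ltn_ord n)) (av n (ltn_ord n))).
rewrite !kg//; last by move=> n nN; apply: L2vZ; exact: ag.
rewrite (ipC (g l)) kg// => h1.
have := ip_ge0 (g l.+1).
(* Expanding the square leaves |g_(l+1)|^2 <= 2 <g_l, g_(l+1)>. *)
have k2 : 0 < 2 * kappa ^+ 2 by rewrite mulr_gt0// exprn_gt0.
move=> h2; rewrite -(pmulr_rge0 _ k2).
have := mulr_ge0 (ltW (exprn_gt0 2 kappa0)) h2.
move: h1; move: (ip _ _) (ip _ _) (ip _ _) => p q r h1 h3; lra.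
Qed.

Lemma control_error_rates l :
  ip (u l) (u l) <= (1 - kappa^-1) ^+ l * ip (u 0%N) (u 0%N) /\
  l%:R * hess_sqr l <= kappa * ip (u 0%N) (u 0%N).
Proof.
have aLu k := Lop_adapted (u k) (au k); have aLg k := Lop_adapted (g k) (ag k).
pose s k := costform alpha (L (g k)) (g k) (L (g k)) (g k).
have LuE k n w : L (u k.+1) n w = L (u k) n w + (- kappa^-1) *: L (g k) n w.
  by apply: Lop_lin => *; exact: uE.
apply: (gradient_descent_rates kappa (fun k => ip (u k) (u k)) hess_sqr
  (fun k => ip (g k) (g k)) s kappa0).
- by move=> k; exact: ip_ge0.
- by move=> k; exact: costform_ge.
- by move=> k; exact: ip_ge0.
- move=> k.
  (* Since H g_k = kappa (g_k - g_(k+1)), the sign of <g_k, g_(k+1)> is the bound <H g_k, g_k> <=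
     kappa |g_k|^2. *)
  have E : ip (g k.+1) (g k) = ip (g k) (g k) + (- kappa^-1) * s k.
    rewrite !ip_g// (costform_lin alpha (L (u k.+1)) (u k.+1) (L (u k)) (u k)
      (L (g k)) (g k) (L (g k)) (g k) (- kappa^-1))//.
  have := ip_gg k; rewrite ipC E; move: (ip _ _) (s k) => p r h.
  have := mulr_ge0 (ltW kappa0) h.
  by rewrite mulrDr mulrA mulrN (mulfV (lt0r_neq0 kappa0)) mulN1r subr_ge0.
- move=> k; rewrite (ip_sqr (u k.+1) (u k) (g k) (- kappa^-1))//.
  rewrite (ipC (u k)) ip_g// -/(hess_sqr k).
  by move: (ip _ _) (ip _ _) (hess_sqr k) => *; ring.
- move=> k; rewrite /hess_sqr (costform_sqr alpha (L (u k.+1)) (u k.+1) (L (u k)) (u k)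
    (L (g k)) (g k) (- kappa^-1))//.
  rewrite -(ip_g k (g k) (ag k)) -/(s k).
  by move: (costform _ _ _ _ _) (s k) (ip _ _) => *; ring.
Qed.

(** The cost is quadratic and its cross term vanishes by optimality, so the excess cost is exactly
    half of [hess_sqr]. *)
Lemma costform_control_error l :
  costform alpha (X l) (U l) (X l) (U l) = costform alpha Xs Us Xs Us + hess_sqr l.
Proof.
have aX := stateh_adapted x0 sig (U l) (aU l).
have aXs := stateh_adapted x0 sig Us aUs.
have aLu := Lop_adapted (u l) (au l).
rewrite (costform_sqr alpha (X l) (U l) Xs Us (L (u l)) (u l) 1)//; last 2 first.
- exact: stateh_control_error.
- move=> n w; rewrite scale1r /control_error.
  by apply/matrixP => i j; rewrite !mxE; ring.
by rewrite optimality_condition// mulr0 addr0 expr1n mul1r.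
Qed.

End gradient_descent.

End discretization.

Theorem theorem4p1 (R : realType) (T alpha kappa : R) :
  0 < T -> 0 <= alpha -> 0 < kappa ->
  exists C : R,
  forall (m : nat) (M S : 'M[R]_m) (x0 : 'cV[R]_m) (sig : nat -> 'cV[R]_m)
         (N : nat) (tau : R)
         (d : measure_display) (Om : measurableType d) (P : probability Om R)
         (W : R -> Om -> R)
         (U : nat -> nat -> Om -> 'cV[R]_m) (Us : nat -> Om -> 'cV[R]_m),
  SPD M -> SPD S ->
  (0 < N)%N -> tau = T / N%:R -> tau <= 1 ->
  is_wiener_process P T W ->
  let F := fun n : nat => aug_nat_filtration P W (n%:R * tau) in
  hessian_norm_le P M S F N tau alpha W kappa ->
  (forall l, in_Uht P M F N (U l)) ->
  (forall l, gd_step P M S F N tau alpha kappa W x0 sig (U l) (U l.+1)) ->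
  in_Uht P M F N Us ->
  (forall V, in_Uht P M F N V ->
     (Jhat P M S N tau alpha W x0 sig Us <= Jhat P M S N tau alpha W x0 sig V)%E) ->
  let Xs := stateh M S tau W x0 sig Us in
  let e0 := normU2 P M N tau (fun n w => U 0%N n w - Us n w) in
  forall l : nat, (0 < l)%N ->
  [/\ (normU2 P M N tau (fun n w => (U l n w - Us n w)%R)
         <= ((1 - kappa^-1) ^+ l)%:E * e0)%E,
      (Jhat P M S N tau alpha W x0 sig (U l) - Jhat P M S N tau alpha W x0 sig Us
         <= (2 * kappa / l%:R)%:E * e0)%E
    & (let Xl := stateh M S tau W x0 sig (U l) in
       \big[Order.max/0%E]_(n < N.+1) Expe P (fun w => qf M (Xs n w - Xl n w)%R)
       + tau%:E * \sum_(n < N) Expe P (fun w => qf S (Xs n.+1 w - Xl n.+1 w)%R)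
         <= (C * (1 - kappa^-1) ^+ l)%:E * e0)%E].
Proof.
(* The energy bound 2 e^(33 T) is spent once on the maximum and once on the gradient sum; the
   constant depends on T only. *)
move=> T0 alpha0 kappa0; exists (4 * expR (33 * T)).
move=> m M S x0 sig N tau d Om P W U Us sM sS N0 tauE tau1 wW F hess inU gd inUs opt Xs e0 l l0.
have NT : N%:R * tau = T by rewrite tauE mulrC divfK// pnatr_eq0 -lt0n.
have tau0 : 0 < tau by rewrite tauE divr_gt0// ltr0n.
have aU k : admissible P tau N W (U k) by apply/(in_Uht_L2v P M T tau N W sM wW (U k)); exact: inU.
have aUs : admissible P tau N W Us by apply/(in_Uht_L2v P M T tau N W sM wW Us).
have optA V : admissible P tau N W V -> (Jhat P M S N tau alpha W x0 sig Us <=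
    Jhat P M S N tau alpha W x0 sig V)%E.
  by move=> aV; apply: opt; apply/(in_Uht_L2v P M T tau N W sM wW V).
have au k := control_error_admissible P T tau N W wW U Us aU aUs k.
have [rate1 rate2] := control_error_rates P M S T tau N W sM sS tau0 NT wW alpha kappa
  x0 sig U Us alpha0 kappa0 hess aU gd aUs optA l.
pose a k := ip P M tau N (control_error U Us k) (control_error U Us k).
have nE k : normU2 P M N tau (fun n w => (U k n w - Us n w)%R) = (a k)%:E.
  exact: (normU2_ip P M T tau N W wW _ (au k)).
rewrite -/(a l) -/(a 0%N) in rate1 rate2.
rewrite /e0 !nE; split.
- by rewrite -EFinM lee_fin.
- rewrite !(Jhat_costform P M S T tau N W tau0 NT wW alpha x0 sig)//.
  rewrite (costform_control_error P M S T tau N W sM tau0 NT wW alpha x0 sig U Us alpha0 aU aUs optA l).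
  rewrite -EFinB -EFinM lee_fin mulrDr addrAC subrr add0r.
  have lr : (0 : R) < l%:R by rewrite ltr0n.
  rewrite mulrAC ler_pdivlMr//.
  have := ip_ge0 P M tau N sM tau0 (control_error U Us 0%N); rewrite -/(a 0%N) => a0.
  (* The rate obtained is kappa / (2 l), four times better than the stated 2 kappa / l. *)
  move: rate2; move: (hess_sqr _ _ _ _ _ _ _ _ _ _) => q rate2.
  have := mulr_ge0 (ltW kappa0) a0; lra.
cbv zeta; set Xl := stateh M S tau W x0 sig (U l).
have XE n w : Xs n w - Xl n w = (-1) *: Lop M S tau W (control_error U Us l) n w.
  rewrite /Xl (stateh_control_error M S tau W x0 sig U Us l n w) -/Xs scale1r scaleN1r.
  by rewrite opprD addrA subrr add0r.
have qfXE B n w : qf B (Xs n w - Xl n w) = qf B (Lop M S tau W (control_error U Us l) n w).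
  by rewrite XE !qfE blZl blZr mulN1r mulN1r opprK.
have aL := Lop_adapted P M S T tau N W tau0 NT wW _ (au l).
have EE B n : (n <= N)%N -> Expe P (fun w => qf B (Xs n w - Xl n w)%R) =
    (Ebl P B (Lop M S tau W (control_error U Us l) n)
            (Lop M S tau W (control_error U Us l) n))%:E.
  move=> nN; rewrite -(Expe_qf P T tau W wW B n)//; last exact: aL.
  by apply: eq_integral => w _; rewrite qfXE.
have bound n : (n <= N)%N -> _ := fun nN =>
  energy_bound P M S T tau N W sM sS tau0 NT wW n _ nN tau1 (au l).
have b0 n : 0 <= 2 * tau * Ebl P S (Lop M S tau W (control_error U Us l) n)
    (Lop M S tau W (control_error U Us l) n).
  by rewrite !mulr_ge0 ?(ltW tau0)//; exact: Ebl_ge0.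
rewrite -/(a l) in bound.
have E0 : 0 <= expR (33 * T) := expR_ge0 _.
have a0 : 0 <= a l := ip_ge0 P M tau N sM tau0 _.
rewrite (eq_bigr (fun n : 'I_N => (Ebl P S (Lop M S tau W (control_error U Us l) n.+1)
  (Lop M S tau W (control_error U Us l) n.+1))%:E)); last by move=> n _; exact: EE.
rewrite sumEFin -!EFinM.
apply: (@le_trans _ _ ((2 * expR (33 * T) * a l)%:E + (2 * expR (33 * T) * a l)%:E)%E).
  apply: leeD.
    apply: bigmax_le => [|n _]; first by rewrite lee_fin mulr_ge0// mulr_ge0.
    have nN : (n <= N)%N by rewrite -ltnS.
    rewrite EE// lee_fin; apply: le_trans (bound n nN).
    by rewrite lerDl; apply: sumr_ge0.
  rewrite lee_fin; have := bound N (leqnn N); rewrite -mulr_sumr.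
  have := Ebl_ge0 P M (Lop M S tau W (control_error U Us l) N) sM.
  have : 0 <= tau * \sum_(j < N) Ebl P S (Lop M S tau W (control_error U Us l) j.+1)
      (Lop M S tau W (control_error U Us l) j.+1).
    by rewrite mulr_ge0 ?(ltW tau0)//; apply: sumr_ge0 => j _; exact: Ebl_ge0.
  lra.
rewrite -EFinD lee_fin; have := ler_wpM2l E0 rate1; lra.
Qed.
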